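(* Let $(V,P,\pi)$ be a lazy reversible Markov chain on a finite tree $T=(V,E)$ with $|V|\ge 3$. Then $$t_{\mathrm{mix}}(\epsilon)-t_{\mathrm{mix}}(1-\epsilon)\le 35\sqrt{\epsilon^{-1}\,t_{\mathrm{rel}}\,t_{\mathrm{mix}}}\qquad\text{for any } 0<\epsilon\le 1/4 .$$ In particular, if $(V_n,P_n,\pi_n)$ is a sequence of lazy reversible Markov chains on finite trees $T_n=(V_n,E_n)$ satisfying the product condition $t_{\mathrm{rel}}^{(n)}=o(t_{\mathrm{mix}}^{(n)})$ as $n\to\infty$, then the sequence exhibits a cutoff with a cutoff window $w_n=\sqrt{t_{\mathrm{rel}}^{(n)}t_{\mathrm{mix}}^{(n)}}$.
   Context: A Markov chain $(V,P,\pi)$ with finite state space $V$, transition matrix $P$ and stationary distribution $\pi$ is a lazy chain on the tree $T=(V,E)$ if $P(x,y)>0$ iff $\{x,y\}\in E$ or $y=x$, and $P(x,x)\ge 1/2$ for all $x$ (such a chain is automatically reversible, i.e. $\pi(x)P(x,y)=\pi(y)P(y,x)$). Time is discrete. Chains have at least two states. The eigenvalues of $P$ are $1=\lambda_1>\lambda_2\ge\dots\ge\lambda_{|V|}\ge 0$, and $t_{\mathrm{rel}}:=(1-\lambda_2)^{-1}$. Let $d(t):=\max_{x}\|P^t(x,\cdot)-\pi\|_{\mathrm{TV}}$, $t_{\mathrm{mix}}(\epsilon):=\inf\{t\ge 0: d(t)\le\epsilon\}$ and $t_{\mathrm{mix}}:=t_{\mathrm{mix}}(1/4)$. A superscript $(n)$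 denotes the quantity for the $n$-th chain of a sequence. A sequence of chains exhibits a cutoff if $\lim_{n\to\infty}t_{\mathrm{mix}}^{(n)}(\epsilon)/t_{\mathrm{mix}}^{(n)}(1-\epsilon)=1$ for every $0<\epsilon<1$. It has a cutoff window $w_n$ if $w_n=o(t_{\mathrm{mix}}^{(n)})$ and for every $\epsilon\in(0,1)$ there is $c_\epsilon>0$ such that $t_{\mathrm{mix}}^{(n)}(\epsilon)-t_{\mathrm{mix}}^{(n)}(1-\epsilon)\le c_\epsilon w_n$ for all $n$. *)

(* Defs.v *)
From HB Require Import structures.
From mathcomp Require Import all_boot all_order all_algebra.
From mathcomp Require Import all_classical all_reals all_analysis.
Set Implicit Arguments.
Unset Strict Implicit.
Unset Printing Implicit Defensive.
Import Order.TTheory GRing.Theory Num.Theory.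
Import numFieldNormedType.Exports.
Local Open Scope classical_set_scope.
Local Open Scope ring_scope.

Definition is_tree (V : finType) (E : rel V) : Prop :=
  [/\ symmetric E, irreflexive E,
      forall x y : V, connect E x y
    & forall c : seq V, ucycle E c -> (size c < 3)%N].

Record markovChain (R : realType) := MarkovChain {
  state :> finType ;
  trans : state -> state -> R ;
  stat : state -> R ;
  trans_ge0 : forall x y, 0 <= trans x y ;
  trans_sum1 : forall x, \sum_(y : state) trans x y = 1 ;
  stat_ge0 : forall x, 0 <= stat x ;
  stat_sum1 : \sum_(x : state) stat x = 1 ;
  stat_stationary : forall y, \sum_(x : state) stat x * trans x y = stat y
}.

Section Chain.
Variables (R : realType) (C : markovChain R).

Definition reversible : Prop :=
  forall x y : C, stat x * trans x y = stat y * trans y x.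

Definition lazy_on (E : rel C) : Prop :=
  (forall x y : C, 0 < trans x y <-> E x y \/ y = x) /\
  (forall x : C, 2^-1 <= trans x x).

Fixpoint trans_iter (t : nat) (x y : C) : R :=
  if t is t'.+1 then \sum_(z : C) trans x z * trans_iter t' z y
  else (x == y)%:R.

Definition trans_mx : 'M[R]_#|C| :=
  \matrix_(i, j) trans (enum_val i) (enum_val j).

(* The eigenvalues with algebraic multiplicity, in nonincreasing order; the
   default [::] is taken only when the characteristic polynomial does not split
   over R, which never happens for a reversible chain with stat positive. *)
Definition eigenvalues : seq R :=
  xget [::] [set s : seq R | sorted >=%R s /\
                 char_poly trans_mx = \prod_(a <- s) ('X - a%:P)].

(* The list is numbered from 0. *)
Definition lambda2 : R := nth 0 eigenvalues 1.

Definition t_rel : R := (1 - lambda2)^-1.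

Definition tv_dist (mu nu : C -> R) : R :=
  2^-1 * \sum_(x : C) `|mu x - nu x|.

Definition mix_dist (t : nat) : R :=
  \big[Num.max/0]_(x : C) tv_dist (trans_iter t x) (@stat R C).

Definition t_mix (eps : R) : R :=
  inf [set t%:R | t in [set t : nat | mix_dist t <= eps]].

End Chain.

Definition exhibits_cutoff (R : realType) (C : nat -> markovChain R) : Prop :=
  forall eps : R, 0 < eps < 1 ->
    (t_mix (C n) eps / t_mix (C n) (1 - eps)) @[n --> \oo] --> (1 : R).

Definition has_cutoff_window (R : realType) (C : nat -> markovChain R)
    (w : nat -> R) : Prop :=
  w =o_\oo (fun n => t_mix (C n) 4^-1) /\
  forall eps : R, 0 < eps < 1 -> exists2 c : R, 0 < c &
    forall n : nat, t_mix (C n) eps - t_mix (C n) (1 - eps) <= c * w n.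

(* Main.v *)
Require Import Defs.
From HB Require Import structures.
From mathcomp Require Import all_boot all_order all_algebra.
From mathcomp Require Import all_classical all_reals all_analysis.
From mathcomp Require Import sesquilinear spectral complex ring lra.
Set Implicit Arguments.
Unset Strict Implicit.
Unset Printing Implicit Defensive.
Import Order.TTheory GRing.Theory Num.Theory.
Import numFieldNormedType.Exports.
Local Open Scope classical_set_scope.
Local Open Scope ring_scope.

(* Let [o] be a centroid of the tree: every component of its complement has
   stationary mass at most 1/2.  The hitting time [T_o] is a sum of independent
   crossing times along the path to [o]; Green's formula on a subtree and the
   Poincare inequality for functions supported on it show that its variance is
   at most [4 t_rel E T_o <= 16 t_rel t_mix], so [T_o] is concentrated on the
   scale [sqrt (t_rel t_mix)].

   Before [t_mix (1 - eps)] the chain cannot have hit [o] with probability close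
   to one, as a stationary start leaves any component within [O(t_rel)] steps.
   After hitting [o], it takes only [O(t_rel)] further steps to meet a set [G] of
   mass at least 7/8: half of the tree is separated from the rest by [o], so
   starting from [o] is no worse than starting from stationarity in that half.
   By a maximal inequality, [G] can be chosen such that from any of its points
   the chain is almost stationary at all later times.

   All probabilistic statements are phrased through the transition operator
   [avg] and the survival probabilities [surv]. *)

(** * Real symmetric matrices *)

(** The hitting time never appears as a random variable: its mean and a bound for its variance solve
    $u-Pu=F$ off [o], which is explicit on a tree, and both Chebyshev bounds are inductions on time.
    The obstacle is to locate an unknown mean. Being within $1-\epsilon$ of stationarity at
    $t_{mix}(1-\epsilon)$ makes a hit shortly afterwards have probability at least $\epsilon/2$,
    which by the lower tail caps the mean; the upper tail then forces a hit a little later except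
    with probability $\epsilon/2$. Missing [G] and the residual distance on [G] cost $\epsilon/4$
    each.

    Chebyshev at level $\epsilon/2$ is the source of $\epsilon^{-1/2}$. The exponential waits would
    need only $\log(1/\epsilon)$, but $e^{-y}\le y^{-2}$ with $y=\epsilon^{-1/2}$ turns each into a
    multiple of $y\,t_{rel}$. With $Z=\sqrt{\epsilon^{-1}t_{rel}t_{mix}}$, the waits 2, 8 and 4 make
    $14\,y\,t_{rel}$, rounding adds at most $2\,y\,t_{rel}$, Chebyshev adds $(34/3)Z$, and
    $y\,t_{rel}\le(10/7)Z$; the total is below $35Z$. *)

Lemma char_poly_similar (F : fieldType) n (A B S : 'M[F]_n) :
  S \in unitmx -> S *m A = B *m S -> char_poly A = char_poly B.
Proof.
move=> Su SA.
have eqmx : map_mx polyC S *m char_poly_mx A = char_poly_mx B *m map_mx polyC S.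
  rewrite /char_poly_mx mulmxBr mulmxBl -!map_mxM SA; congr (_ - _).
  by rewrite scalar_mxC.
have /(congr1 determinant) := eqmx.
rewrite !det_mulmx mulrC => /mulIf; apply.
by rewrite det_map_mx polyC_eq0 -unitfE -unitmxE.
Qed.

(** The complexified matrix has a unitary diagonalisation $U$ with real eigenvalues; [Ur] and [Ui]
    are the real and imaginary parts of $U$. Comparing real and imaginary parts in the unitarity
    relations and in $UA=DU$ gives the listed identities. *)
Lemma real_symmetric_spectral (R : rcfType) n (A : 'M[R]_n) : A^T = A ->
  exists d : 'rV[R]_n, exists Ur, exists Ui : 'M[R]_n,
    [/\ Ur^T *m Ur + Ui^T *m Ui = 1%:M,
        Ur *m Ur^T + Ui *m Ui^T = 1%:M,
        Ui *m Ur^T = Ur *m Ui^T,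
        Ur *m A = diag_mx d *m Ur /\ Ui *m A = diag_mx d *m Ui
      & char_poly A = \prod_(k < n) ('X - (d 0 k)%:P)].
Proof.
move=> symA.
pose toC := real_complex R.
pose AC : 'M[R[i]]_n := map_mx toC A.
have hermA : AC \is hermsymmx.
  apply: realsym_hermsym.
    by apply/is_hermitianmxP; rewrite expr0 scale1r map_mx_id// map_trmx symA.
  by apply/mxOverP => i j; rewrite mxE; apply/complex_realP; exists (A i j).
have /mxOverP dreal := hermitian_spectral_diag_real hermA.
have normA := hermitian_normalmx hermA.
have /orthomx_spectralP specA := normA.
set U := spectralmx AC in specA.
set D := spectral_diag AC in specA dreal.
have Uunit : U \is unitarymx := spectral_unitarymx AC.
have UA : U *m AC = diag_mx D *m U.
  by rewrite specA !mulmxA mulmxV ?mul1mx ?spectral_unit.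
pose d := map_mx (@complex.Re R) D.
have DE : D = map_mx toC d.
  by apply/matrixP => i j; rewrite !mxE /toC RRe_real.
pose Ur := map_mx (@complex.Re R) U; pose Ui := map_mx (@complex.Im R) U.
have UE i j : U i j = (Ur i j +i* Ui i j)%C by rewrite !mxE; case: (U i j).
have UU : U *m (U^t*)%sesqui = 1%:M by apply/unitarymxP.
have UU' : (U^t*)%sesqui *m U = 1%:M by apply: mulmx1C.
have sumRe (I : finType) (f : I -> R[i]) : complex.Re (\sum_i f i) = \sum_i complex.Re (f i).
  by elim/big_rec2: _ => // i y1 y2 _ <-; case: (f i) y2 => [? ?] [].
have sumIm (I : finType) (f : I -> R[i]) : complex.Im (\sum_i f i) = \sum_i complex.Im (f i).
  by elim/big_rec2: _ => // i y1 y2 _ <-; case: (f i) y2 => [? ?] [].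
have conjE (z : R[i]) : Num.conj z = (complex.Re z -i* complex.Im z)%C by case: z.
have natRe (b : bool) : complex.Re (b%:R : R[i]) = b%:R by case: b.
have natIm (b : bool) : complex.Im (b%:R : R[i]) = 0 by case: b.
exists d, Ur, Ui; split.
- apply/matrixP => i j; have /matrixP/(_ i j)/(congr1 (@complex.Re R)) := UU'.
  rewrite !mxE natRe => <-; rewrite sumRe -big_split /=; apply: eq_bigr => k _.
  rewrite !mxE conjE; case: (U k i) (U k j) => [a b] [a' b'] /=.
  by rewrite mulNr opprK.
- apply/matrixP => i j; have /matrixP/(_ i j)/(congr1 (@complex.Re R)) := UU.
  rewrite !mxE natRe => <-; rewrite sumRe -big_split /=; apply: eq_bigr => k _.
  rewrite !mxE conjE; case: (U i k) (U j k) => [a b] [a' b'] /=.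
  by rewrite mulrN opprK.
- apply/eqP; rewrite -subr_eq0; apply/eqP/matrixP => i j.
  have /matrixP/(_ i j)/(congr1 (@complex.Im R)) := UU.
  rewrite !mxE natIm => h; apply: etrans h; rewrite sumIm -sumrB; apply: eq_bigr => k _.
  rewrite !mxE conjE; case: (U i k) (U j k) => [a b] [a' b'] /=.
  by rewrite mulrN addrC.
- split; apply/matrixP => i j; have /matrixP/(_ i j) := UA.
    move/(congr1 (@complex.Re R)); rewrite !mul_diag_mx !mxE sumRe.
    rewrite DE !mxE [complex.Re (_ * _)](_ : _ = d 0 i * Ur i j); last first.
      by rewrite !mxE; case: (U i j) => a b /=; rewrite mul0r subr0.
    rewrite !mxE => <-; apply: eq_bigr => k _; rewrite !mxE.
    by case: (U i k) => a b /=; rewrite mulr0 subr0.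
  move/(congr1 (@complex.Im R)); rewrite !mul_diag_mx !mxE sumIm.
  rewrite DE !mxE [complex.Im (_ * _)](_ : _ = d 0 i * Ui i j); last first.
    by rewrite !mxE; case: (U i j) => a b /=; rewrite mul0r addr0.
  rewrite !mxE => <-; apply: eq_bigr => k _; rewrite !mxE.
  by case: (U i k) => a b /=; rewrite mulr0 add0r.
- apply: (map_inj_poly (complexI (R := R))) => //.
  rewrite map_char_poly -/AC rmorph_prod /=.
  rewrite (char_poly_similar _ UA) ?spectral_unit// char_poly_trig ?diag_mx_is_trig//.
  apply: eq_bigr => k _; rewrite rmorphB /= map_polyX map_polyC /= DE.
  by rewrite !mxE eqxx mulr1n.
Qed.

(** Rows of $U$ with eigenvalue 1 are multiples of [psi], hence vanish against [v]; all others have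
    eigenvalue at most [nth 0 s 1], because 1 occurs only once in [s]. *)
Lemma symmetric_second_eigenvalue (R : rcfType) n (A : 'M[R]_n) (psi : 'cV[R]_n)
    (s : seq R) :
  A^T = A -> psi^T *m psi = 1%:M -> A *m psi = psi ->
  (forall v : 'cV_n, A *m v = v -> exists c, v = c *: psi) ->
  (forall (v : 'cV_n) a, A *m v = a *: v -> v != 0 -> a <= 1) ->
  (1 < n)%N -> sorted >=%R s -> char_poly A = \prod_(a <- s) ('X - a%:P) ->
  nth 0 s 1 < 1 /\
  forall v : 'cV_n, psi^T *m v = 0 ->
    (v^T *m A *m v) 0 0 <= nth 0 s 1 * (v^T *m v) 0 0.
Proof.
move=> symA psi1 Apsi simpl1 le1 n1 srt chs.
have [d [Ur [Ui [UU1 UU2 UU3 [UrA UiA] chd]]]] := real_symmetric_spectral symA.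
pose ds := [seq d 0 k | k <- enum 'I_n].
have prm : perm_eq s ds.
  by apply: prod_XsubC_eq; rewrite -chs chd /ds big_map big_enum.
have eigU (M : 'M[R]_n) k : M *m A = diag_mx d *m M ->
    A *m (row k M)^T = d 0 k *: (row k M)^T.
  move=> MA; rewrite -{1}symA -trmx_mul -row_mul MA -linearZ /=; congr (_^T).
  by apply/rowP => j; rewrite mul_diag_mx !mxE.
have rowr k : d 0 k = 1 -> exists c, row k Ur = c *: psi^T.
  move=> dk; have := eigU _ k UrA; rewrite dk scale1r => /simpl1 [c] hc.
  by exists c; rewrite -[LHS]trmxK hc linearZ.
have rowi k : d 0 k = 1 -> exists c, row k Ui = c *: psi^T.
  move=> dk; have := eigU _ k UiA; rewrite dk scale1r => /simpl1 [c] hc.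
  by exists c; rewrite -[LHS]trmxK hc linearZ.
have dotE (a b : R) : (a *: psi^T *m (b *: psi^T)^T) = (a * b)%:M.
  by rewrite linearZ /= trmxK -scalemxAl -scalemxAr psi1 scalerA scalemx1.
have entE (M N : 'M[R]_n) k l : (M *m N^T) k l = (row k M *m (row l N)^T) 0 0.
  by rewrite !mxE; apply: eq_bigr => i _; rewrite !mxE.
have addE p q (M N : 'M[R]_(p, q)) k l : (M + N) k l = M k l + N k l by rewrite mxE.
have uniq1 k l : d 0 k = 1 -> d 0 l = 1 -> k = l.
  move=> dk dl; apply/eqP; apply/negPn/negP => nkl.
  have [a1 h1] := rowr k dk; have [a2 h2] := rowr l dl.
  have [b1 g1] := rowi k dk; have [b2 g2] := rowi l dl.
  have /matrixP/(_ k l) := UU2; have /matrixP/(_ k k) := UU2.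
  have /matrixP/(_ l l) := UU2; have /matrixP/(_ k l) := UU3.
  rewrite !addE !entE h1 h2 g1 g2 !dotE.
  rewrite !mxE !eqxx (negbTE nkl) !mulr1n !mulr0n => e1 e2 e3 e4.
  (* For the complex coefficients $z_1,z_2$ of the two rows along [psi] this is
     $|z_1|^2|z_2|^2=|z_1\bar z_2|^2$: normalisation makes the left side 1, orthogonality makes the
     right side 0. *)
  have : (a1 * a1 + b1 * b1) * (a2 * a2 + b2 * b2)
    = (a1 * a2 + b1 * b2) ^+ 2 + (b1 * a2 - a1 * b2) ^+ 2.
    by rewrite !expr2 !(mulrDl, mulrDr, mulrBl, mulrBr); lra.
  by rewrite e2 e3 e4 e1 subrr mulr1 expr0n /= addr0; apply/eqP/oner_neq0.
have mem_s a : (a \in s) = eigenvalue A a.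
  by rewrite eigenvalue_root_char chs root_prod_XsubC.
have s_le1 a : a \in s -> a <= 1.
  rewrite mem_s => /eigenvalueP [v vA v0]; apply: (le1 v^T).
    by rewrite -{1}symA -trmx_mul vA linearZ.
  by apply: contra_neq v0 => /(congr1 trmx); rewrite trmxK trmx0.
have in1 : 1 \in s.
  rewrite mem_s; apply/eigenvalueP; exists psi^T.
    by rewrite -{1}symA -trmx_mul Apsi scale1r.
  apply/eqP => psi0; move: psi1; rewrite psi0 mul0mx => /matrixP/(_ 0 0).
  by rewrite !mxE eqxx => /esym/eqP; rewrite oner_eq0.
have count1 : (count_mem (1%R : R) s <= 1)%N.
  rewrite (permP prm) /ds count_map -size_filter; set ks := seq.filter _ _.
  have ksP k : k \in ks -> d 0 k = 1 by rewrite mem_filter => /andP[/eqP].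
  have : uniq ks by rewrite filter_uniq ?enum_uniq.
  case: ks ksP => [|k [|l ks]] //= ksP.
  rewrite (uniq1 k l) ?inE ?eqxx //; apply: ksP; rewrite !inE eqxx ?orbT //.
have sz : size s = n by rewrite (perm_size prm) size_map size_enum_ord.
have : exists a b t, s = [:: a, b & t].
  by case: s sz {srt chs prm mem_s s_le1 in1 count1} n1 => [|a [|b t]] <- // _; exists a, b, t.
move=> [a [b [t sE]]].
move: srt; rewrite sE /= => /andP[ba pb].
have tb x : x \in t -> x <= b.
  have /allP := order_path_min (rev_trans le_trans) pb; by apply.
have a1 : a = 1.
  apply/le_anti; rewrite (s_le1 a) ?sE ?inE ?eqxx //=.
  move: in1; rewrite sE !inE => /or3P[/eqP -> // | /eqP -> // | /tb h].
  exact: le_trans h ba.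
have b1 : b < 1.
  rewrite lt_neqAle -{2}a1 ba andbT; apply/eqP => b1.
  by move: count1; rewrite sE /= a1 b1 eqxx.
split=> // v psiv.
have d_le k : d 0 k != 1 -> d 0 k <= b.
  move=> dk; have : d 0 k \in s by rewrite (perm_mem prm) map_f ?mem_enum.
  rewrite sE !inE a1 (negbTE dk) /= => /orP[/eqP -> // | /tb //].
have coefE (M : 'M[R]_n) : M *m A = diag_mx d *m M ->
    (forall k, d 0 k = 1 -> exists c, row k M = c *: psi^T) ->
    (v^T *m (M^T *m M) *m A *m v) 0 0 <= b * (v^T *m (M^T *m M) *m v) 0 0.
  move=> MA Mpsi; rewrite !mulmxA -2!(mulmxA _ M) -trmx_mul MA -!mulmxA.
  rewrite mul_diag_mx !mxE mulr_sumr; apply: ler_sum => k _.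
  rewrite !mxE -!/((M *m v) k 0).
  have [dk|/d_le dk] := eqVneq (d 0 k) 1.
    have [c hc] := Mpsi k dk.
    have -> : \sum_j M k j * v j 0 = 0.
      have /matrixP/(_ 0 0) := congr1 (fun M => M *m v) hc.
      by rewrite -scalemxAl psiv scaler0 !mxE => h; apply: etrans h; apply: eq_bigr => j _; rewrite !mxE.
    by rewrite !mulr0.
  by rewrite mulrCA ler_wpM2r // -expr2 sqr_ge0.
have := lerD (coefE _ UrA rowr) (coefE _ UiA rowi).
rewrite -mulrDr -!addE -!mulmxDl -!mulmxDr UU1 mulmx1.
by [].
Qed.

(** * The transition operator *)

Lemma discriminant_le (R : realFieldType) (a b c : R) : 0 <= c ->
  (forall t, 0 <= a - 2 * t * b + t ^+ 2 * c) -> b ^+ 2 <= a * c.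
Proof.
move=> c0 h; have [c_eq0|c_neq0] := eqVneq c 0.
  have [->|b0] := eqVneq b 0; first by rewrite c_eq0 mulr0 expr0n.
  (* At this [t] the quadratic expression equals -1. *)
  have := h ((a + 1) / (2 * b)); rewrite c_eq0 mulr0 addr0.
  have -> : 2 * ((a + 1) / (2 * b)) * b = a + 1 by field.
  lra.
have cp : 0 < c by rewrite lt_def c_neq0.
have := h (b / c).
have -> : a - 2 * (b / c) * b + (b / c) ^+ 2 * c = (a * c - b ^+ 2) / c by field.
by rewrite pmulr_lge0 ?invr_gt0// subr_ge0.
Qed.

Section WeightedOperators.
Variables (R : realType) (C : markovChain R).
Implicit Types f g h : C -> R.

Definition avg f (x : C) : R := \sum_(y : C) trans x y * f y.
Definition mean f : R := \sum_(x : C) stat x * f x.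
Definition dot f g : R := \sum_(x : C) stat x * (f x * g x).
Definition mass (A : pred C) : R := \sum_(x : C | A x) stat x.
(** The cut-off on both sides of [avg] keeps the operator self-adjoint and positive. *)
Definition killed (A : pred C) f (x : C) : R :=
  (~~ A x)%:R * avg (fun y => (~~ A y)%:R * f y) x.

Lemma dotC f g : dot f g = dot g f.
Proof. by apply: eq_bigr => x _; rewrite [f x * _]mulrC. Qed.

Lemma dotBl a f g h : dot (fun x => f x - a * g x) h = dot f h - a * dot g h.
Proof. by rewrite /dot mulr_sumr -sumrB; apply: eq_bigr => x _; ring. Qed.

Lemma dotBr a f g h : dot h (fun x => f x - a * g x) = dot h f - a * dot h g.
Proof. by rewrite dotC dotBl !(dotC h). Qed.

Lemma dot_ge0 f : 0 <= dot f f.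
Proof.
by apply: sumr_ge0 => x _; rewrite mulr_ge0 ?stat_ge0 // -expr2 sqr_ge0.
Qed.

Lemma mean_le f g : (forall x, f x <= g x) -> mean f <= mean g.
Proof. by move=> fg; apply: ler_sum => x _; rewrite ler_wpM2l ?stat_ge0. Qed.

Lemma meanD f g : mean (fun x => f x + g x) = mean f + mean g.
Proof. by rewrite /mean -big_split; apply: eq_bigr => x _; rewrite mulrDr. Qed.

Lemma meanZ a f : mean (fun x => a * f x) = a * mean f.
Proof. by rewrite /mean mulr_sumr; apply: eq_bigr => x _; rewrite mulrCA. Qed.

Lemma mean_cst a : mean (fun=> a) = a.
Proof. by rewrite /mean -mulr_suml stat_sum1 mul1r. Qed.

Lemma mean_sum n (F : nat -> C -> R) :
  mean (fun x => \sum_(j < n) F j x) = \sum_(j < n) mean (F j).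
Proof.
by rewrite /mean exchange_big; apply: eq_bigr => x _; rewrite mulr_sumr.
Qed.

Lemma mean_indic (A : pred C) : mean (fun x => (A x)%:R) = mass A.
Proof.
rewrite /mean /mass [RHS]big_mkcond; apply: eq_bigr => x _.
by case: (A x); rewrite ?mulr1 ?mulr0.
Qed.

Lemma mass_ge0 A : 0 <= mass A.
Proof. by apply: sumr_ge0 => x _; apply: stat_ge0. Qed.

Lemma massC A : mass (predC A) = 1 - mass A.
Proof. by apply/eqP; rewrite eq_sym subr_eq -(stat_sum1 C) (bigID A) /= addrC. Qed.

Lemma mass_sub (A B : pred C) : (forall x, A x -> B x) -> mass A <= mass B.
Proof.
move=> AB; rewrite -!mean_indic; apply: mean_le => x.
by case: (A x) (AB x) => [->|_] //; case: (B x).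
Qed.

Lemma mass_le1 A : mass A <= 1.
Proof. by have := mass_ge0 (predC A); rewrite massC subr_ge0. Qed.

Lemma massD (A B : pred C) : mass A <= mass B + mass (predD A B).
Proof.
rewrite -!mean_indic -meanD; apply: mean_le => x /=.
by case: (A x); case: (B x); rewrite ?addr0 ?add0r ?ler01 ?lexx.
Qed.

Lemma avgB a f g : avg (fun x => f x - a * g x) = fun x => avg f x - a * avg g x.
Proof.
apply/funext => x; rewrite /avg mulr_sumr -sumrB.
by apply: eq_bigr => y _; ring.
Qed.

Lemma avg_cst a : avg (fun=> a) = fun=> a.
Proof. by apply/funext => x; rewrite /avg -mulr_suml trans_sum1 mul1r. Qed.

Lemma avg_le f g : (forall x, f x <= g x) -> forall x, avg f x <= avg g x.
Proof. by move=> fg x; apply: ler_sum => y _; rewrite ler_wpM2l ?trans_ge0. Qed.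

Lemma avgDc f a x : avg (fun y => f y + a) x = avg f x + a.
Proof.
rewrite -[in RHS](mul1r a) -(trans_sum1 x) mulr_suml -big_split.
by apply: eq_bigr => y _; rewrite mulrDr.
Qed.

Lemma mean_avg f : mean (avg f) = mean f.
Proof.
rewrite /mean /avg; under eq_bigr do rewrite mulr_sumr.
rewrite exchange_big; apply: eq_bigr => y _ /=.
rewrite -(stat_stationary y) mulr_suml.
by apply: eq_bigr => x _; rewrite mulrA.
Qed.

Lemma trans_iterE n f x :
  \sum_(y : C) trans_iter n x y * f y = iter n avg f x.
Proof.
elim: n x => [|n IH] x /=.
  rewrite (bigD1 x) //= eqxx mul1r big1 ?addr0 // => y yx.
  by rewrite eq_sym (negbTE yx) mul0r.
under eq_bigr do rewrite mulr_suml.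
rewrite exchange_big; apply: eq_bigr => z _ /=; rewrite -IH mulr_sumr.
by apply: eq_bigr => y _; rewrite mulrA.
Qed.

Lemma killedB A a f g :
  killed A (fun x => f x - a * g x) = fun x => killed A f x - a * killed A g x.
Proof.
apply/funext => x; rewrite /killed.
have -> : (fun y => (~~ A y)%:R * (f y - a * g y)) =
  (fun y => (~~ A y)%:R * f y - a * ((~~ A y)%:R * g y)).
  by apply/funext => y; ring.
by rewrite avgB; ring.
Qed.

Hypothesis rev : reversible C.

Lemma avg_selfadjoint f g : dot (avg f) g = dot f (avg g).
Proof.
rewrite /dot /avg.
under eq_bigr do rewrite mulr_suml mulr_sumr.
under [RHS]eq_bigr do rewrite mulr_sumr mulr_sumr.
rewrite exchange_big; apply: eq_bigr => y _; apply: eq_bigr => x _ /=.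
have := rev x y => e; transitivity ((stat x * trans x y) * (f y * g x)); first by ring.
by rewrite e; ring.
Qed.

Lemma killedE A f g :
  dot (killed A f) g = dot (avg (fun y => (~~ A y)%:R * f y)) (fun y => (~~ A y)%:R * g y).
Proof. by apply: eq_bigr => x _; rewrite /killed; ring. Qed.

Lemma killed_selfadjoint A f g : dot (killed A f) g = dot f (killed A g).
Proof. by rewrite killedE avg_selfadjoint dotC -killedE dotC. Qed.

Lemma dirichlet f : 2 * (dot f f - dot (avg f) f) =
  \sum_x \sum_y stat x * trans x y * (f y - f x) ^+ 2.
Proof.
have a1 : \sum_x \sum_y stat x * trans x y * (f x * f x) = dot f f.
  apply: eq_bigr => x _; rewrite -[RHS]mul1r -(trans_sum1 x) mulr_suml.
  by apply: eq_bigr => w _; ring.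
have a2 : \sum_x \sum_y stat x * trans x y * (f y * f y) = dot f f.
  rewrite exchange_big -a1; apply: eq_bigr => y _; apply: eq_bigr => x _ /=.
  by rewrite (rev x y).
have a3 : \sum_x \sum_y stat x * trans x y * (f x * f y) = dot (avg f) f.
  apply: eq_bigr => x _; rewrite /avg mulr_suml mulr_sumr.
  by apply: eq_bigr => y _; ring.
rewrite mulr2n mulrDl !mul1r -{1}a1 -{1}a2 -!a3 -!sumrB -big_split.
apply: eq_bigr => x _ /=.
by rewrite -!sumrB -big_split; apply: eq_bigr => y _ /=; ring.
Qed.

Hypothesis lz : forall x : C, 2^-1 <= trans x x.

(** The sum $\frac12\sum\pi(x)P(x,y)(f(x)+f(y))^2$ equals $\langle f,f\rangle+\langle Pf,f\rangle$,
    and by laziness its diagonal terms alone amount to at least $\langle f,f\rangle$. *)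
Lemma avg_psd f : 0 <= dot (avg f) f.
Proof.
have sq0 : dot f f <= 2^-1 * \sum_x \sum_y stat x * trans x y * (f x + f y) ^+ 2.
  rewrite mulr_sumr; apply: ler_sum => x _.
  rewrite (bigD1 x) //= mulrDr.
  apply: le_trans (_ : 2^-1 * (stat x * trans x x * (f x + f x) ^+ 2) <= _).
    have -> : 2^-1 * (stat x * trans x x * (f x + f x) ^+ 2)
      = stat x * (f x * f x) * (2 * trans x x) by field.
    have h0 : 0 <= stat x * (f x * f x) by rewrite mulr_ge0 ?stat_ge0 -?expr2 ?sqr_ge0.
    by have := lz x; nra.
  rewrite lerDl mulr_ge0 ?invr_ge0 // sumr_ge0 // => y _.
  by rewrite mulr_ge0 ?sqr_ge0 // mulr_ge0 ?stat_ge0 ?trans_ge0.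
suff e : 2^-1 * (\sum_x \sum_y stat x * trans x y * (f x + f y) ^+ 2)
    = dot f f + dot (avg f) f by move: sq0; rewrite e; lra.
have e1 : \sum_x \sum_y stat x * trans x y * (f x * f x) = dot f f.
  apply: eq_bigr => x _; rewrite -[RHS]mul1r -(trans_sum1 x) mulr_suml.
  by apply: eq_bigr => y _; ring.
have e2 : \sum_x \sum_y stat x * trans x y * (f y * f y) = dot f f.
  rewrite exchange_big -e1; apply: eq_bigr => y _; apply: eq_bigr => x _ /=.
  by rewrite (rev x y).
have e3 : \sum_x \sum_y stat x * trans x y * (f x * f y) = dot (avg f) f.
  apply: eq_bigr => x _; rewrite /avg mulr_suml mulr_sumr.
  by apply: eq_bigr => y _; ring.
have -> : \sum_x \sum_y stat x * trans x y * (f x + f y) ^+ 2 =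
  \sum_x \sum_y stat x * trans x y * (f x * f x)
  + \sum_x \sum_y stat x * trans x y * (f y * f y)
  + 2 * \sum_x \sum_y stat x * trans x y * (f x * f y).
  rewrite mulr_sumr -!big_split; apply: eq_bigr => x _ /=.
  rewrite mulr_sumr -!big_split; apply: eq_bigr => y _ /=.
  by ring.
by rewrite e1 e2 e3; field.
Qed.

Lemma killed_psd A f : 0 <= dot (killed A f) f.
Proof. by rewrite killedE avg_psd. Qed.

(** * Powers of a positive self-adjoint operator *)

Section Decay.
(** [Q] will be [avg] on functions of mean zero, or [killed A] on all functions; [S] is the
    invariant class on which the form of [Q] is at most [b]. *)
Variables (Q : (C -> R) -> C -> R) (S : (C -> R) -> Prop) (b : R).
Hypothesis QB : forall a f g,
  Q (fun x => f x - a * g x) = fun x => Q f x - a * Q g x.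
Hypothesis Qsa : forall f g, dot (Q f) g = dot f (Q g).
Hypothesis Qpsd : forall f, 0 <= dot (Q f) f.
Hypothesis QS : forall f, S f -> S (Q f).
Hypothesis b0 : 0 <= b.
Hypothesis Qb : forall f, S f -> dot (Q f) f <= b * dot f f.

Lemma dot_iterD m n f : dot (iter m Q f) (iter n Q f) = dot (iter (m + n) Q f) f.
Proof.
elim: n m => [|n IH] m; first by rewrite addn0.
by rewrite addnS -addSn -IH /= Qsa.
Qed.

(* The square [dot (Q f) (Q f)] is controlled by expanding the positive form
   of [Q] at [f - Q f / b]. *)
Lemma dot_sq_le f : S f -> dot (Q f) (Q f) <= b * dot (Q f) f.
Proof.
move=> Sf.
have H t : 2 * t * dot (Q f) (Q f) - t ^+ 2 * (b * dot (Q f) (Q f)) <= dot (Q f) f.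
  have := Qpsd (fun x => f x - t * Q f x).
  rewrite QB !(dotBl, dotBr) [dot (Q (Q f)) f]Qsa.
  have := ler_wpM2l (sqr_ge0 t) (Qb (QS Sf)).
  rewrite !expr2 => h1 h2; have := sqr_ge0 t; nra.
have [bz|bn] := eqVneq b 0.
  have := H 1; have := Qb Sf; have := dot_ge0 (Q f); rewrite bz !mul0r; nra.
have bp : 0 < b by rewrite lt_def bn.
have := H b^-1; rewrite -(ler_pM2l bp); apply: le_trans.
by rewrite le_eqVlt; apply/orP; left; apply/eqP; field.
Qed.

(** Self-adjointness halves the exponent: for even [n] this is the form bound at the half iterate,
    for odd [n] it is [dot_sq_le] there. *)
Lemma dot_iter_step n f : S f ->
  dot (iter n.+1 Q f) f <= b * dot (iter n Q f) f.
Proof.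
move=> Sf; have Sn k : S (iter k Q f) by elim: k => //= k; apply: QS.
rewrite -[n](odd_double_half n); case: (odd n); rewrite -addnn ?add0n ?add1n.
  have := dot_sq_le (Sn n./2).
  by rewrite -!iterS !dot_iterD addSn addnS.
by have := Qb (Sn n./2); rewrite -!iterS !dot_iterD addSn.
Qed.

Lemma dot_iter_le n f : S f -> dot (iter n Q f) f <= b ^+ n * dot f f.
Proof.
move=> Sf; elim: n => [|n IH]; first by rewrite mul1r.
by apply: le_trans (dot_iter_step n Sf) _; rewrite exprS -mulrA ler_wpM2l.
Qed.

Lemma dot_iter_ge0 n f : 0 <= dot (iter n Q f) f.
Proof.
rewrite -[n](odd_double_half n); case: (odd n); rewrite -addnn ?add0n ?add1n.
  by have := Qpsd (iter n./2 Q f); rewrite -!iterS !dot_iterD addSn.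
by rewrite -!dot_iterD; apply: dot_ge0.
Qed.

(** With $h=Q^kf$, the second difference is $\|h-Qh\|^2$ for $n=2k$ and $\langle
    Q(h-Qh),h-Qh\rangle$ for $n=2k+1$. *)
Lemma dot_iter_convex n f :
  0 <= dot (iter n Q f) f - 2 * dot (iter n.+1 Q f) f + dot (iter n.+2 Q f) f.
Proof.
rewrite -[n](odd_double_half n); case: (odd n); rewrite -addnn ?add0n ?add1n.
  set k := n./2; set h := iter k Q f.
  have := Qpsd (fun x => h x - 1 * Q h x).
  rewrite QB !(dotBl, dotBr) -[Q h]/(iter k.+1 Q f) -[Q (iter _ _ _)]/(iter k.+2 Q f).
  rewrite /h !dot_iterD !(addSn, addnS); lra.
set k := n./2; set h := iter k Q f.
have := dot_ge0 (fun x => h x - 1 * Q h x).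
rewrite !(dotBl, dotBr) -[Q h]/(iter k.+1 Q f).
rewrite /h !dot_iterD !(addSn, addnS); lra.
Qed.

End Decay.

End WeightedOperators.

Arguments avg {R C} f x.
Arguments killed {R C} A f x.

(** * Hitting times and the maximal inequality *)

Lemma telescope_ord (V : zmodType) (F : nat -> V) s k :
  F (s + k)%N = F s + \sum_(i < k) (F (s + i).+1 - F (s + i)%N).
Proof.
elim: k => [|k IH]; first by rewrite big_ord0 addr0 addn0.
by rewrite big_ord_recr /= addrA -IH addnS addrC subrK.
Qed.

Section Hitting.
Variables (R : realType) (C : markovChain R).
Implicit Types (f g h : C -> R) (A : pred C).

(* [surv A n x] is the probability that the chain started at [x] avoids [A] at
   the times [0, ..., n]. *)
Fixpoint surv (A : pred C) (n : nat) (x : C) : R :=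
  if A x then 0 else if n is n'.+1 then avg (surv A n') x else 1.

Lemma surv_in A n x : A x -> surv A n x = 0.
Proof. by case: n => [|n] /= ->. Qed.

Lemma surv0 A x : surv A 0 x = (~~ A x)%:R.
Proof. by rewrite /=; case: (A x). Qed.

Lemma survS A n x : ~~ A x -> surv A n.+1 x = avg (surv A n) x.
Proof. by move=> /negbTE /= ->. Qed.

Lemma surv_ge0 A n x : 0 <= surv A n x.
Proof.
elim: n x => [|n IH] x /=; case: ifP => // _.
by apply: sumr_ge0 => y _; rewrite mulr_ge0 ?trans_ge0.
Qed.

Lemma survS_le A n x : surv A n.+1 x <= surv A n x.
Proof.
elim: n x => [|n IH] x.
  rewrite /=; case: ifP => // _.
  rewrite -[leRHS](trans_sum1 x); apply: ler_sum => y _.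
  by rewrite -[leRHS]mulr1 ler_wpM2l ?trans_ge0 //; case: (A y).
have [Ax|nAx] := boolP (A x); first by rewrite !surv_in.
by rewrite !survS //; apply: avg_le.
Qed.

Lemma surv_le A m n x : (m <= n)%N -> surv A n x <= surv A m x.
Proof.
by move/subnK <-; elim: (n - m)%N => // k IH; apply: le_trans (survS_le _ _ _) IH.
Qed.

Lemma surv_le1 A n x : surv A n x <= 1.
Proof. by apply: le_trans (surv_le _ _ (leq0n n)) _; rewrite surv0; case: (A x). Qed.

Lemma surv_sub (A B : pred C) n x :
  (forall y, A y -> B y) -> surv B n x <= surv A n x.
Proof.
move=> AB; elim: n x => [|n IH] x.
  by rewrite !surv0; case: (A x) (AB x) => [->|] //; case: (B x).
have [Bx|nBx] := boolP (B x); first by rewrite surv_in ?surv_ge0.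
have nAx : ~~ A x by apply: contra nBx; apply: AB.
by rewrite !survS //; apply: avg_le.
Qed.

(** Makes survival probabilities accessible to the spectral bounds. *)
Lemma surv_killed A n : surv A n = iter n (killed A) (fun x => (~~ A x)%:R).
Proof.
elim: n => [|n IH]; first by apply/funext => x; rewrite surv0.
apply/funext => x; rewrite iterS -IH /killed.
have [Ax|nAx] := boolP (A x); first by rewrite surv_in // mul0r.
rewrite survS // mul1r; congr (avg _ _); apply/funext => y.
by case: (boolP (A y)) => Ay; rewrite ?mul1r // !surv_in // mulr0.
Qed.

(** Surviving up to time [n] entails being outside [A] at time [n]. *)
Lemma surv_le_iter A n g x :
  (forall y, (~~ A y)%:R <= g y) -> (forall y, 0 <= g y) -> surv A n x <= iter n avg g x.
Proof.
move=> Ag g0; have gn k y : 0 <= iter k avg g y.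
  by elim: k y => //= k IH y; apply: sumr_ge0 => z _; rewrite mulr_ge0 ?trans_ge0.
elim: n x => [|n IH] x; first by rewrite surv0 Ag.
have [Ax|nAx] := boolP (A x); first by rewrite surv_in.
by rewrite survS // iterS; apply: avg_le.
Qed.

Lemma survD_le A m n x : surv A (m + n) x <= iter m avg (surv A n) x.
Proof.
elim: m x => [|m IH] x //; have [Ax|nAx] := boolP (A x).
  rewrite surv_in // iterS; apply: sumr_ge0 => y _; rewrite mulr_ge0 ?trans_ge0 //.
  by apply: le_trans (IH y); apply: surv_ge0.
by rewrite addSn survS // iterS; apply: avg_le.
Qed.

(** Strong Markov property at [o]: after a visit to [o] by time [m], at least [n] steps remain in
    which [A] must be avoided. *)
Lemma surv_through A (o : C) m n x :
  surv A (m + n) x <= surv (pred1 o) m x + surv A n o.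
Proof.
elim: m x => [|m IH] x.
  rewrite surv0 /=; have [->|xo] /= := eqVneq x o; first by rewrite add0r.
  by apply: le_trans (surv_le1 _ _ _) _; rewrite lerDl surv_ge0.
have [->|xo] := eqVneq x o.
  by rewrite (@surv_in (pred1 o)) ?add0r ?surv_le ?leq_addl //= eqxx.
have [Ax|nAx] := boolP (A x); first by rewrite surv_in // addr_ge0 ?surv_ge0.
rewrite addSn !survS // -avgDc; exact: avg_le.
Qed.

(** Strong Markov property at the first visit to [A]: if it occurs by time [n], the remaining time
    lies between [s] and [n + s], where [d] applies; otherwise [f] is bounded by 1. *)
Lemma iter_avg_le_surv A s n f d x : (forall y, f y <= 1) -> 0 <= d ->
  (forall y j, A y -> (s <= j <= n + s)%N -> iter j avg f y <= d) ->
  iter (n + s) avg f x <= surv A n x + d.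
Proof.
move=> f1 d0; elim: n x => [|n IH] x Ad.
  have [Ax|nAx] := boolP (A x).
    by rewrite surv_in // add0r; apply: Ad => //; rewrite leq_addl ?leqnn.
  rewrite surv0 nAx add0n /= mulr1n; suff : iter s avg f x <= 1 by lra.
  elim: s x {Ad nAx} => //= s IH x; rewrite -[leRHS](trans_sum1 x).
  by apply: ler_sum => y _; rewrite -[leRHS]mulr1 ler_wpM2l ?trans_ge0.
have [Ax|nAx] := boolP (A x).
  by rewrite surv_in // add0r; apply: Ad => //; rewrite leq_addl ?leqnn.
rewrite survS // -avgDc addSn iterS; apply: avg_le => y; apply: IH => z j Az.
by move=> /andP[sj jn]; apply: Ad => //; rewrite sj (leq_trans jn).
Qed.

(** * Consequences of a spectral gap *)

Section Gap.
Hypothesis rev : reversible C.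
Hypothesis lz : forall x : C, 2^-1 <= trans x x.
Variable lam : R.
Hypothesis lam0 : 0 <= lam.
Hypothesis lam1 : lam < 1.
Hypothesis gap : forall g, mean g = 0 -> dot (avg g) g <= lam * dot g g.

Lemma dot_cst f a : dot f (fun=> a) = a * mean f.
Proof. by rewrite /dot /mean mulr_sumr; apply: eq_bigr => x _; ring. Qed.

Lemma avg_gap g :
  dot (avg g) g <= lam * dot g g + (1 - lam) * mean g ^+ 2.
Proof.
set mu := mean g; pose g' x := g x - mu * 1.
have mg' : mean g' = 0.
  have -> : g' = (fun x => g x + - mu) by apply/funext => x; rewrite /g' mulr1.
  by rewrite meanD mean_cst subrr.
have := gap mg'; rewrite /g' avgB !(dotBl, dotBr).
rewrite avg_cst ![dot (fun=> 1) _]dotC !dot_cst mean_avg mean_cst -/mu.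
rewrite !expr2; lra.
Qed.

(** Cauchy-Schwarz for [g] and the indicator of the complement of [A], read off from the quadratic
    form $t\mapsto\sum_{x\notin A}\pi(x)(g(x)-t)^2$. *)
Lemma mean_supp_sq A g : (forall x, A x -> g x = 0) ->
  mean g ^+ 2 <= dot g g * (1 - mass A).
Proof.
move=> gA; apply: discriminant_le; first by rewrite subr_ge0 mass_le1.
move=> t; rewrite -massC -mean_indic.
have -> : dot g g - 2 * t * mean g + t ^+ 2 * mean (fun x => (predC A x)%:R)
  = \sum_x stat x * ((g x - t) ^+ 2 * (~~ A x)%:R).
  rewrite /dot /mean !mulr_sumr -sumrB -big_split; apply: eq_bigr => x _ /=.
  by case: (boolP (A x)) => [/gA -> | _] /=; ring.
apply: sumr_ge0 => x _; rewrite mulr_ge0 ?stat_ge0 // mulr_ge0 ?sqr_ge0 //.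
Qed.

Lemma killed_rate_ge0 A : 0 <= 1 - (1 - lam) * mass A.
Proof.
have := mulr_ge0 (ltW (_ : 0 < 1 - lam)) (_ : 0 <= 1 - mass A).
rewrite subr_gt0 subr_ge0 mass_le1 => /(_ lam1 isT); have := lam0; lra.
Qed.

(** A function supported off [A] cannot be close to a constant: [mean_supp_sq] in [avg_gap] gives
    the rate $\lambda+(1-\lambda)(1-\pi(A))$. *)
Lemma killed_gap A g :
  dot (killed A g) g <= (1 - (1 - lam) * mass A) * dot g g.
Proof.
rewrite killedE; set g' := fun y => _.
have g'A x : A x -> g' x = 0 by rewrite /g' => ->; rewrite mul0r.
have := avg_gap g'; have := mean_supp_sq g'A.
have gg' : dot g' g' <= dot g g.
  apply: ler_sum => x _; rewrite ler_wpM2l ?stat_ge0 // /g'.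
  by case: (A x); rewrite ?mul1r // !mul0r -expr2 sqr_ge0.
have b0 := killed_rate_ge0 A.
have := ler_wpM2l b0 gg'; have l1 : 0 <= 1 - lam by rewrite subr_ge0 ltW.
move=> h1 h2 h3; move: (ler_wpM2l l1 h2) h1 h3; lra.
Qed.

(** The mean is the form of the [n]-th power of [killed A] at the indicator of the complement of
    [A], whose squared norm is the factor [1 - mass A]. *)
Lemma mean_surv_le A n :
  mean (surv A n) <= (1 - mass A) * (1 - (1 - lam) * mass A) ^+ n.
Proof.
have b0 := killed_rate_ge0 A.
have -> : mean (surv A n) = dot (iter n (killed A) (fun x => (~~ A x)%:R))
                                (fun x => (~~ A x)%:R).
  rewrite -surv_killed; apply: eq_bigr => x _; congr (_ * _).
  by case: (boolP (A x)) => Ax; rewrite ?mulr1 // surv_in ?mulr0.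
apply: le_trans (_ : (1 - (1 - lam) * mass A) ^+ n *
  dot (fun x => (~~ A x)%:R) (fun x => (~~ A x)%:R) <= _).
  apply: (@dot_iter_le _ _ (killed A) (fun=> True)) => //.
  - by move=> *; apply: killedB.
  - by move=> f g; apply: killed_selfadjoint.
  - by move=> f; apply: killed_psd.
  - by move=> f _; apply: killed_gap.
rewrite mulrC; rewrite le_eqVlt; apply/orP; left; apply/eqP; congr (_ * _).
rewrite -massC -mean_indic; apply: eq_bigr => x _ /=.
by case: (A x); rewrite ?mulr0 ?mulr1.
Qed.

(** * A maximal inequality for the iterates of a centred function *)

Section Maximal.
Variable f : C -> R.
Hypothesis f0 : mean f = 0.
Let u j := iter j avg f.
Let a i := dot (u i) f.

Let aD i j : dot (u i) (u j) = a (i + j).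
Proof. by rewrite /a /u (dot_iterD (avg_selfadjoint rev)). Qed.

Let a_step i : a i.+1 <= lam * a i.
Proof.
apply: (dot_iter_step (S := fun g => mean g = 0)) => //.
- by move=> *; apply: avgB.
- exact: avg_selfadjoint.
- exact: avg_psd.
- by move=> g; rewrite mean_avg.
Qed.

Let a_ge0 i : 0 <= a i.
Proof.
by apply: dot_iter_ge0; [exact: avg_selfadjoint | exact: avg_psd].
Qed.

Let a_dec i : a i.+1 <= a i.
Proof. by apply: le_trans (a_step i) _; rewrite ler_piMl ?a_ge0 // ltW. Qed.

Let a_convex i : 0 <= a i - 2 * a i.+1 + a i.+2.
Proof.
apply: dot_iter_convex.
- by move=> *; apply: avgB.
- exact: avg_selfadjoint.
- exact: avg_psd.
Qed.

Lemma dot_iter_avg_le n : a n <= lam ^+ n * dot f f.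
Proof.
elim: n => [|n IH]; first by rewrite mul1r.
by apply: le_trans (a_step n) _; rewrite exprS -mulrA ler_wpM2l.
Qed.

Let da i : a i.+1 - a i.+2 <= a i - a i.+1.
Proof. by have := a_convex i; lra. Qed.

Let da_le i j : (i <= j)%N -> a j - a j.+1 <= a i - a i.+1.
Proof.
by move/subnK <-; elim: (j - i)%N => // k IH; apply: le_trans (da _) IH.
Qed.

Let T := (1 - lam)^-1.
Let T0 : 0 < T. Proof. by rewrite invr_gt0 subr_gt0. Qed.

Let mean_sq j : mean (fun x => u j x ^+ 2) = a (j + j).
Proof. by rewrite -aD. Qed.

Let increment j :
  mean (fun x => `|u j.+1 x ^+ 2 - u j x ^+ 2|)
    <= T * ((a (j + j) - a (j + j).+1) - (a (j.+1 + j.+1) - a (j.+1 + j.+1).+1))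
       + (a (j + j) - a (j.+1 + j.+1)).
Proof.
have bnd x : `|u j.+1 x ^+ 2 - u j x ^+ 2| <=
    T * (u j.+1 x - u j x) ^+ 2 + T^-1 / 2 * (u j.+1 x ^+ 2 + u j x ^+ 2).
  have h (v w : R) : v ^+ 2 - w ^+ 2 <= T * (v - w) ^+ 2 + T^-1 / 2 * (v ^+ 2 + w ^+ 2).
    rewrite -(ler_pM2l T0).
    have -> : T * (T * (v - w) ^+ 2 + T^-1 / 2 * (v ^+ 2 + w ^+ 2)) =
      (T * (v - w)) ^+ 2 + (v ^+ 2 + w ^+ 2) / 2 by field; rewrite gt_eqF.
    (* These two squares give $T(v-w)(v+w)\le T^2(v-w)^2+(v+w)^2/4$ and $(v+w)^2\le 2(v^2+w^2)$. *)
    have := sqr_ge0 (T * (v - w) - (v + w) / 2); have := sqr_ge0 (v - w).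
    rewrite !expr2; nra.
  rewrite ler_norml h andbT lerNl opprB; apply: le_trans (h _ _) _.
  by rewrite -sqrrN opprB [X in _ <= _ + _ * X]addrC.
apply: le_trans (mean_le bnd) _.
rewrite meanD !meanZ meanD !mean_sq.
have -> : mean (fun x => (u j.+1 x - u j x) ^+ 2) =
  a (j.+1 + j.+1) - 2 * a (j + j).+1 + a (j + j).
  transitivity (dot (fun x => u j.+1 x - 1 * u j x) (fun x => u j.+1 x - 1 * u j x)).
    by apply: eq_bigr => x _; rewrite expr2 mul1r.
  by rewrite !(dotBl, dotBr) !aD !(addSn, addnS); ring.
(* Convexity replaces the drop of [a] at $2j+1$ by the smaller one at $2j+2$, so that the bound
   telescopes in steps of two. *)
have h1 : a (j + j).+1 - a (j + j).+2 >= a (j.+1 + j.+1) - a (j.+1 + j.+1).+1.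
  by rewrite addSn addnS; apply: da_le.
have h2 : T^-1 * a (j + j) <= a (j + j) - a (j.+1 + j.+1).
  rewrite /T invrK addSn addnS; have := a_step (j + j); have := a_dec (j + j).+1; lra.
have h3 : T^-1 * a (j.+1 + j.+1) <= T^-1 * a (j + j).
  apply: ler_wpM2l; first by rewrite invr_ge0 ltW.
  rewrite addSn addnS.
  exact: le_trans (a_dec _) (a_dec _).
have := ler_wpM2l (ltW T0) h1.
move: h2 h3; rewrite !(addSn, addnS); lra.
Qed.

(* A substitute for Starr's maximal inequality: the total variation of
   [j |-> (P^j f)^2] is bounded in mean by
   [|u^2 - v^2| <= T (u - v)^2 + (u^2 + v^2) / (2 T)], and both sums telescope
   because [i |-> <P^i f, f>] is nonnegative, convex and decays geometrically. *)
Lemma maximal_inequality s n : exists2 g : C -> R,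
  forall x j, (s <= j <= s + n)%N -> (iter j avg f x) ^+ 2 <= g x
  & mean g <= 2 * dot (iter (s + s) avg f) f
              + T * dot (iter s avg f) f / s.+1%:R.
Proof.
pose inc i x := `|u i.+1 x ^+ 2 - u i x ^+ 2|.
pose g x := u s x ^+ 2 + \sum_(i < n) inc (s + i)%N x.
exists g.
  move=> x j /andP[/subnK <-]; rewrite addnC leq_add2l => jn.
  rewrite -/(u _) /g; set k := (j - s)%N in jn *.
  have -> : u (s + k)%N x ^+ 2 = u s x ^+ 2 + \sum_(i < k) (u (s + i).+1 x ^+ 2 - u (s + i)%N x ^+ 2).
    exact: (telescope_ord (fun i => u i x ^+ 2)).
  rewrite lerD2l (big_ord_widen n (fun i => u (s + i).+1 x ^+ 2 - u (s + i)%N x ^+ 2)) //.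
  rewrite big_mkcond /=; apply: ler_sum => i _; case: ifP => _; last exact: normr_ge0.
  exact: ler_norm.
rewrite /g meanD mean_sq (mean_sum n (fun i => inc (s + i)%N)).
have -> : dot (iter (s + s) avg f) f = a (s + s) by [].
have -> : dot (iter s avg f) f = a s by [].
have H : \sum_(i < n) mean (inc (s + i)%N) <=
  T * ((a (s + s) - a (s + s).+1) - (a ((s + n) + (s + n)) - a ((s + n) + (s + n)).+1))
  + (a (s + s) - a ((s + n) + (s + n))).
  elim: (n) => [|k IH]; first by rewrite big_ord0 !addn0 !subrr mulr0 addr0.
  rewrite big_ord_recr /=; have := increment (s + k); rewrite -/(inc _).
  by rewrite !(addSn, addnS) in IH *; lra.
have h1 : 0 <= a ((s + n) + (s + n)) - a ((s + n) + (s + n)).+1.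
  by rewrite subr_ge0 a_dec.
(* The drop at $2s$ is at most each of the [s.+1] drops from $s$ to $2s$, and these add up to at
   most [a s]. *)
have h2 : (a (s + s) - a (s + s).+1) * s.+1%:R <= a s.
  have : \sum_(i < s.+1) (a (s + i) - a (s + i).+1) <= a s.
    apply: le_trans (_ : a s - a (s + s.+1) <= _); last by have := a_ge0 (s + s.+1); lra.
    rewrite le_eqVlt; apply/orP; left; apply/eqP.
    by rewrite (telescope_ord a s s.+1) opprD addNKr -sumrN; apply: eq_bigr => i _; rewrite opprB.
  apply: le_trans; rewrite mulr_natr -[X in _ *+ X]card_ord -sumr_const.
  by apply: ler_sum => i _; apply: da_le; rewrite leq_add2l -ltnS.
have h3 : a (s + s) - a (s + s).+1 <= a s / s.+1%:R by rewrite ler_pdivlMr ?ltr0n.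
have := ler_wpM2l (ltW T0) h3; have := ler_wpM2l (ltW T0) h1.
have := a_ge0 ((s + n) + (s + n)); move: H; rewrite mulr0 mulrA.
move: (\sum_(i < n) _) (T * a s / _) (a (s + s)) (a (s + s).+1) (a (_ + _)) (a _.+1) => a1 a2 a3 a4 a5 a6.
by move: T => T'; lra.
Qed.

End Maximal.
End Gap.
End Hitting.

(** * Rooted trees *)

Section RootedTree.
Variables (V : finType) (E : rel V).

Fixpoint reach (n : nat) (x y : V) : bool :=
  if n is n'.+1 then [exists z, E x z && reach n' z y] else x == y.

Lemma reach_rcons n x y z : reach n x y -> E y z -> reach n.+1 x z.
Proof.
elim: n x => [|n IH] x; first by move=> /eqP -> yz; apply/existsP; exists z; rewrite yz /=.
move=> /existsP[w /andP[xw wy]] yz; apply/existsP; exists w; rewrite xw.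
exact: IH.
Qed.

Lemma connect_reach x y : connect E x y -> exists n, reach n x y.
Proof.
move=> /connectP[q]; elim: q x => [|z q IH] x /=; first by move=> _ ->; exists 0%N => /=.
move=> /andP[xz zq] ylast; have [n rn] := IH z zq ylast.
by exists n.+1; apply/existsP; exists z; rewrite xz.
Qed.

Hypothesis Etree : is_tree E.

Let Esym : symmetric E. Proof. by case: Etree. Qed.
Let Eirr : irreflexive E. Proof. by case: Etree. Qed.
Let Econn x y : exists n, reach n x y.
Proof. by apply: connect_reach; case: Etree. Qed.

Definition dist x y := ex_minn (Econn x y).

Lemma reach_dist x y : reach (dist x y) x y.
Proof. by rewrite /dist; case: ex_minnP. Qed.

Lemma dist_le n x y : reach n x y -> (dist x y <= n)%N.
Proof. by rewrite /dist; case: ex_minnP => m _; apply. Qed.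

Lemma distxx x : dist x x = 0%N.
Proof. by apply/eqP; rewrite -leqn0; apply: dist_le => /=. Qed.

Lemma dist_stepl x y z : E x z -> (dist x y <= (dist z y).+1)%N.
Proof.
by move=> xz; apply: dist_le; apply/existsP; exists z; rewrite xz; apply: reach_dist.
Qed.

Lemma dist_stepr x y z : E y z -> (dist x z <= (dist x y).+1)%N.
Proof. by move=> yz; apply: dist_le; apply: reach_rcons yz; apply: reach_dist. Qed.

Lemma dist_next x y : x != y -> exists2 z, E x z & dist x y = (dist z y).+1.
Proof.
move=> xy; have := reach_dist x y; case ed: (dist x y) => [|n] /=.
  by move=> exy; rewrite exy in xy.
move=> /existsP[z /andP[xz zy]]; exists z => //; congr _.+1.
apply/eqP; rewrite eqn_leq dist_le // andbT.
by have := dist_stepl y xz; rewrite ed ltnS.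
Qed.

Variable o : V.

(** The root is its own parent, so iteration stops there. Off the root a neighbour one step closer
    always exists, and the default [x] is never taken. *)
Definition parent x :=
  if x == o then o
  else odflt x [pick z | E x z && (dist x o == (dist z o).+1)].

Lemma parent_root : parent o = o.
Proof. by rewrite /parent eqxx. Qed.

Lemma parentP x : x != o -> E x (parent x) /\ dist x o = (dist (parent x) o).+1.
Proof.
rewrite /parent => xo; rewrite (negbTE xo); case: pickP => [z /andP[? /eqP] //|np].
by have [z xz dz] := dist_next xo; have := np z; rewrite xz dz eqxx.
Qed.

Lemma depth_ind (P : V -> Prop) :
  P o -> (forall x, x != o -> P (parent x) -> P x) -> forall x, P x.
Proof.
move=> Po PS x; have [n] := ubnP (dist x o); elim: n x => // n IH x.
have [-> //|xo] := eqVneq x o; have [_ dx] := parentP xo.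
by rewrite dx ltnS => dn; apply: PS => //; apply: IH.
Qed.

(* If an edge were not of the form [x -- parent x], following parents from its
   two ends to the root would close it into a simple cycle. *)
Lemma edge_parent x y : E x y -> (x != o /\ y = parent x) \/ (y != o /\ x = parent y).
Proof.
move=> xy; have [/andP[xo /eqP yx]|nx] := boolP ((x != o) && (y == parent x)).
  by left.
have [/andP[yo /eqP xy']|ny] := boolP ((y != o) && (x == parent y)).
  by right.
exfalso.
have xNy : x != y by apply/eqP => e; move: xy; rewrite e Eirr.
pose E' u v := E u v && ~~ (((u == x) && (v == y)) || ((u == y) && (v == x))).
have E'sym : symmetric E'.
  by move=> u v; rewrite /E' Esym; congr (_ && ~~ _); rewrite orbC andbC [X in _ || X]andbC.
have to_o z : connect E' z o.
  apply: (depth_ind (P := fun z => connect E' z o)) => // {}z zo; apply: connect_trans.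
  apply: connect1; rewrite /E'; have [-> _] := parentP zo => /=.
  apply/negP => /orP[] /andP[/eqP zx /eqP pz].
    by move: nx; rewrite -zx zo -pz eqxx.
  by move: ny; rewrite -zx zo -pz eqxx.
have : connect E' x y.
  by apply: connect_trans (to_o x) _; rewrite (sym_connect_sym E'sym) to_o.
move=> /connectP[q0 pq0 lq0]; move: pq0 lq0; case/shortenP => q pq uq _ lq.
have pE : path E x q by apply: sub_path pq => u v /andP[].
have [_ _ _ /(_ (x :: q))] := Etree.
have cyc : ucycle E (x :: q).
  by apply/andP; split=> //=; rewrite rcons_path pE -lq Esym.
move=> /(_ cyc); case: q {uq cyc pE} pq lq => [|z [|w q]] //= .
  by move=> _ e; rewrite e eqxx in xNy.
by move=> /andP[+ _] e; rewrite -e /E' !eqxx andbF.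
Qed.

(** [y] lies on the path from [x] to the root; for fixed [y], the [x] with [anc x y] form the
    subtree hanging from [y]. *)
Definition anc x y := fconnect parent x y.

Lemma ancxx x : anc x x. Proof. exact: connect0. Qed.

Lemma anc_step x y : anc x y = (x == y) || anc (parent x) y.
Proof.
apply/idP/orP => [/connectP[[|z q] /=]|[/eqP -> | h]].
- by move=> _ ->; left.
- move=> /andP[/eqP <- pq] ->; right; apply/connectP; by exists q.
- exact: ancxx.
- by apply: connect_trans h; apply: connect1; rewrite /= eqxx.
Qed.

Lemma anc_root y : anc o y = (o == y).
Proof.
apply/idP/eqP => [/connectP[q]|<-]; last exact: ancxx.
elim: q => [|z q IH] //= /andP[/eqP]; rewrite parent_root => <-; exact: IH.
Qed.

Lemma anc_dist x y : anc x y -> (dist x y + dist y o <= dist x o)%N.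
Proof.
elim/depth_ind: x => [|x xo IH]; first by rewrite anc_root => /eqP <-; rewrite distxx.
have [Ex dx] := parentP xo.
rewrite anc_step => /orP[/eqP <- | /IH h].
  by rewrite distxx.
rewrite dx; apply: leq_trans (_ : (dist (parent x) y).+1 + dist y o <= _)%N.
  by rewrite leq_add2r dist_stepl.
by rewrite addSn ltnS.
Qed.

Lemma anc_parentF x : x != o -> anc (parent x) x = false.
Proof.
move=> xo; apply/negP => /anc_dist; have [_ ->] := parentP xo.
by rewrite addnS ltnNge leq_addl.
Qed.

Lemma anc_parent x y : anc x y -> anc x (parent y).
Proof. by move=> xy; apply: connect_trans xy _; apply: connect1; rewrite /= eqxx. Qed.

Lemma anc_card x y : x != o -> y != o ->
  (anc x y : nat) = ((x == y) + anc (parent x) y)%N.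
Proof.
move=> xo yo; rewrite anc_step; have [<-|_] //= := eqVneq x y.
by rewrite anc_parentF.
Qed.

(** A subtree is the disjoint union of its top and the subtrees of the children, stated for
    indicators so that it can be summed. From [parent w] to [w] both sides grow by the indicator of
    [w] itself. *)
Lemma anc_children w y : y != o ->
  (anc w y : nat) = ((w == y) + \sum_(z | (z != o) && (parent z == y)) anc w z)%N.
Proof.
move=> yo; elim/depth_ind: w => [|w wo IH].
  rewrite anc_root eq_sym (negbTE yo) big1 // => z /andP[zo _].
  by rewrite anc_root eq_sym (negbTE zo).
rewrite anc_card // IH; congr (_ + _)%N.
under [RHS]eq_bigr => z /andP[zo _] do rewrite anc_card //.
rewrite big_split /=; congr (_ + _)%N.
have [e|ne] := eqVneq (parent w) y.
  rewrite (bigD1 w) /= ?wo ?e ?eqxx // big1 // => z /andP[_ /negbTE].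
  by rewrite eq_sym => ->.
rewrite big1 // => z /andP[_ /eqP pz]; case: eqP => // wz.
by rewrite wz pz eqxx in ne.
Qed.

Lemma top_child x : x != o -> exists c, [/\ c != o, parent c = o & anc x c].
Proof.
elim/depth_ind: x => [|x xo IH _]; first by rewrite eqxx.
have [px|px] := eqVneq (parent x) o; first by exists x; split=> //; exact: ancxx.
by have [c [? ? h]] := IH px; exists c; split=> //; rewrite anc_step h orbT.
Qed.

Lemma anc_closed c y z : c != o -> parent c = o -> anc y c -> E y z -> z != o -> anc z c.
Proof.
move=> co pc yc /edge_parent h zo; case: h => [[yo e]|[_ e]].
  move: yc; rewrite anc_step -e => /orP[/eqP yc|//].
  by rewrite e yc pc eqxx in zo.
by rewrite anc_step -e yc orbT.
Qed.

End RootedTree.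

(** * Potentials on a tree *)

Section TreeChain.
Variables (R : realType) (C : markovChain R) (E : rel C).
Hypothesis Et : is_tree E.
Hypothesis lzE : lazy_on E.
Hypothesis rev : reversible C.

Let Esym : symmetric E. Proof. by case: Et. Qed.
Let lz (x : C) : 2^-1 <= trans x x. Proof. exact: lzE.2. Qed.

Lemma trans_edge x y : E x y -> 0 < trans x y.
Proof. by move=> xy; apply/lzE.1; left. Qed.

Lemma trans_nonedge x y : ~~ E x y -> y != x -> trans x y = 0.
Proof.
move=> xy yx; apply/eqP; rewrite eq_le trans_ge0 andbT leNgt; apply/negP.
by move=> /lzE.1[h|h]; [rewrite h in xy | rewrite h eqxx in yx].
Qed.

(** Root the tree at some state of positive mass; detailed balance carries positivity across each
    edge. *)
Lemma stat_gt0 (x : C) : 0 < stat x.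
Proof.
have [x0 hx0] : exists x0 : C, 0 < stat x0.
  have [/existsP //|/existsPn h] := boolP [exists x0 : C, 0 < stat x0].
  have : \sum_(x : C) stat x <= 0.
    by apply: sumr_le0 => y _; have := h y; rewrite -leNgt.
  by rewrite stat_sum1 ler10.
elim/(depth_ind (Etree := Et) (o := x0)): x => // x xo IH.
have [Ex _] := parentP Et xo.
rewrite lt_def stat_ge0 andbT; apply/eqP => sx.
have := rev x (parent Et x0 x); rewrite sx mul0r => /esym/eqP.
by rewrite mulf_eq0 !gt_eqF // trans_edge // Esym.
Qed.

(** Take [o] minimising the stationary mean distance. Moving to a child [c] shortens the distance by
    1 from everywhere below [c] and lengthens it by at most 1 elsewhere, so minimality bounds the
    mass below [c]; deeper subtrees are contained in these. *)
Lemma centroid_exists : exists o : C, forall v : C,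
  v != o -> mass (fun z : C => anc Et o z v) <= 2^-1.
Proof.
have [x0 _] : exists x0 : C, true.
  have [/existsP //|/existsPn h] := boolP [exists x0 : C, true].
  have := stat_sum1 C; rewrite big1 => [|x _]; last by have := h x.
  by move=> /esym/eqP; rewrite oner_eq0.
pose F (c : C) : R := \sum_(x : C) stat x * (dist Et x c)%:R.
exists [arg min_(c < x0) F c]%O; case: arg_minP => // o _ omin v.
have top c : c != o -> parent Et o c = o -> mass (fun z : C => anc Et o z c) <= 2^-1.
  move=> co pc; have := omin c isT; rewrite -subr_ge0 /F -sumrB => h.
  have h' : 0 <= mean (fun x : C => 1 - 2 * (anc Et o x c)%:R).
    apply: le_trans h _; apply: ler_sum => x _.
    rewrite -mulrBr ler_wpM2l ?stat_ge0 //.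
    have [Ec dc] := parentP Et co; rewrite pc in Ec dc.
    have [xc|_] := boolP (anc Et o x c).
      have := anc_dist xc; rewrite dc distxx addn1 -(ler_nat R) -natr1 /= mulr1n; lra.
    have : (dist Et x c <= (dist Et x o).+1)%N by apply: dist_stepr; rewrite Esym.
    rewrite -(ler_nat R) -natr1 /= mulr0n; lra.
  move: h'; have -> : (fun x : C => 1 - 2 * (anc Et o x c)%:R) =
    (fun x : C => 1 + (-2) * (anc Et o x c)%:R :> R) by apply/funext => x; lra.
  rewrite meanD mean_cst (meanZ (-2)) (mean_indic (fun x : C => anc Et o x c)); lra.
elim/(depth_ind (Etree := Et) (o := o)): v => [|v vo IH _]; first by rewrite eqxx.
have [pv|pv] := eqVneq (parent Et o v) o; first exact: top.
by apply: le_trans (IH pv); apply: mass_sub => x; apply: anc_parent.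
Qed.

Variable o : C.
Local Notation par := (parent Et o).
Local Notation under y := (fun z : C => anc Et o z y).
Implicit Types (F g m v : C -> R).

Definition flow F (y : C) : R := \sum_(z : C | anc Et o z y) stat z * F z.

(* The solution of [u - avg u = F] off the root which vanishes at the root:
   the drop of [u] across the edge from [y] to its parent is the total of [F]
   below [y] divided by the conductance of that edge. *)
Definition potential F (x : C) : R :=
  \sum_(y : C | (y != o) && anc Et o x y) flow F y / (stat y * trans y (par y)).

Let cond_gt0 y : y != o -> 0 < stat y * trans y (par y).
Proof. by move=> yo; rewrite mulr_gt0 ?stat_gt0 // trans_edge //; case: (parentP Et yo). Qed.

Lemma potential_root F : potential F o = 0.
Proof.
by rewrite /potential big1 // => y /andP[yo]; rewrite anc_root eq_sym (negbTE yo).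
Qed.

Lemma potential_step F x : x != o ->
  (potential F x - potential F (par x)) * (stat x * trans x (par x)) = flow F x.
Proof.
move=> xo.
have -> : potential F x = flow F x / (stat x * trans x (par x)) + potential F (par x).
  rewrite /potential (bigD1 x) /= ?xo ?ancxx //; congr (_ + _); apply: eq_bigl => y.
  rewrite [anc Et o x y]anc_step [x == y]eq_sym.
  have [->|_] /= := eqVneq y x; first by rewrite anc_parentF // !andbF.
  by rewrite andbT.
by rewrite addrK divfK // gt_eqF ?cond_gt0.
Qed.

Lemma flow_children F y : y != o ->
  flow F y = stat y * F y + \sum_(z : C | (z != o) && (par z == y)) flow F z.
Proof.
move=> yo; rewrite /flow big_mkcond /=.
under [X in _ = _ + X]eq_bigr do rewrite big_mkcond /=.
rewrite exchange_big /= [X in X + _](_ : _ = \sum_(w : C) (w == y)%:R * (stat w * F w)).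
  rewrite -big_split /=; apply: eq_bigr => w _.
  have e z : (if anc Et o w z then stat w * F w else 0) =
      (anc Et o w z)%:R * (stat w * F w).
    by case: (anc _ _ w z); rewrite ?mul1r ?mul0r.
  under eq_bigr do rewrite e.
  rewrite -mulr_suml -natr_sum -mulrDl -natrD -anc_children //.
rewrite (bigD1 y) //= eqxx mul1r big1 ?addr0 // => w /negbTE ->.
by rewrite mul0r.
Qed.

(** Conservation of flow at [y]: what leaves towards the parent is what comes from the children plus
    the source [stat y * F y]. *)
Lemma potential_solves F y : y != o -> potential F y = avg (potential F) y + F y.
Proof.
move=> yo; set U := potential F.
have H : stat y * (U y - avg U y) = stat y * F y.
  have -> : stat y * (U y - avg U y) = \sum_z stat y * trans y z * (U y - U z).
    rewrite /avg -[X in stat y * (X - _)]mul1r -(trans_sum1 y) mulr_suml -sumrB mulr_sumr.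
    by apply: eq_bigr => z _; ring.
  (* Only the parent and the children of [y] contribute; reversibility turns each child's edge into
     the one of [potential_step]. *)
  have -> : \sum_z stat y * trans y z * (U y - U z) =
     \sum_z ((z == par y)%:R * flow F y - ((z != o) && (par z == y))%:R * flow F z).
    apply: eq_bigr => z _.
    have [zy|zy] := eqVneq z (par y).
      rewrite zy mul1r -(potential_step F yo) -/U.
      have [e|ne] /= := eqVneq (par (par y)) y; last by rewrite andbF mul0r; ring.
      have [py|py] := eqVneq (par y) o; first by rewrite mul0r; ring.
      have [_] := parentP Et yo; have [_ ->] := parentP Et py; rewrite e => /eqP.
      by rewrite eqn_leq -ltnS andbC ltnNge leqnSn.
    have [pz|pz] /= := eqVneq (par z) y.
      have [zo|zo] /= := eqVneq z o.
        by move: yo; rewrite -pz zo parent_root eqxx.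
      by rewrite -(potential_step F zo) -/U pz mul0r mul1r rev; ring.
    rewrite andbF !mul0r subr0.
    have [->|zNy] := eqVneq z y; first by rewrite subrr mulr0.
    rewrite trans_nonedge ?mulr0 ?mul0r //; apply/negP => /(edge_parent Et o).
    by move=> [[_ e]|[_ e]]; [rewrite e eqxx in zy | rewrite e eqxx in pz].
  rewrite sumrB (bigD1 (par y)) //= eqxx mul1r [X in _ + X - _]big1 => [|z /negbTE ->]; last by rewrite mul0r.
  rewrite flow_children // addr0 [X in _ - X](_ : _ = \sum_(z : C | (z != o) && (par z == y)) flow F z) ?addrK //.
  rewrite [RHS]big_mkcond; apply: eq_bigr => z _; case: ifP => _; by rewrite ?mul1r ?mul0r.
have {}H := mulfI (negbT (gt_eqF (stat_gt0 y))) H.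
by rewrite -H addrC subrK.
Qed.

Lemma flow_le F G y : (forall z, F z <= G z) -> flow F y <= flow G y.
Proof. by move=> FG; apply: ler_sum => z _; rewrite ler_wpM2l ?stat_ge0. Qed.

Lemma potential_le F G x : (forall y, y != o -> flow F y <= flow G y) ->
  potential F x <= potential G x.
Proof.
move=> FG; apply: ler_sum => y /andP[yo _].
apply: ler_wpM2r; last exact: FG.
by rewrite invr_ge0 ltW ?cond_gt0.
Qed.

Lemma potentialZ a F x : potential (fun z => a * F z) x = a * potential F x.
Proof.
rewrite /potential mulr_sumr; apply: eq_bigr => y _; rewrite mulrA; congr (_ / _).
by rewrite /flow mulr_sumr; apply: eq_bigr => z _; rewrite mulrCA.
Qed.

Lemma potential_ge0 F x : (forall z, 0 <= F z) -> 0 <= potential F x.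
Proof.
move=> F0; have -> : 0 = potential (fun z => 0 * F z) x by rewrite potentialZ mul0r.
by apply: potential_le => y yo; apply: flow_le => z; rewrite mul0r.
Qed.

Definition hit_mean : C -> R := potential (fun=> 1).
Definition hit_energy (y : C) : R :=
  \sum_(z : C) trans y z * (hit_mean z - hit_mean y) ^+ 2.
(** Since [hit_mean] drops by 1 on average in a step off the root, its one-step variance is
    [hit_energy] minus 1. Leaving out this 1 makes [hit_var] an upper bound for the variance and
    [hit_energy] the density of a Dirichlet form. *)
Definition hit_var : C -> R := potential hit_energy.

Lemma hit_mean_ge0 x : 0 <= hit_mean x.
Proof. by apply: potential_ge0 => _; apply: ler01. Qed.

Lemma hit_var_ge0 x : 0 <= hit_var x.
Proof.
by apply: potential_ge0 => y; apply: sumr_ge0 => z _; rewrite mulr_ge0 ?trans_ge0 ?sqr_ge0.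
Qed.

(** A supermartingale up to the hit: [a] is the time left until a fixed target, hence decreases by
    one per step. *)
Lemma hit_step x a : x != o ->
  avg (fun y => hit_var y + (hit_mean y - (a - 1)) ^+ 2) x
    <= hit_var x + (hit_mean x - a) ^+ 2.
Proof.
move=> xo; have hm := potential_solves (fun=> 1) xo; have hv := potential_solves hit_energy xo.
rewrite -/hit_mean in hm; rewrite -/hit_var in hv.
rewrite [hit_var x]hv.
have -> : avg (fun y => hit_var y + (hit_mean y - (a - 1)) ^+ 2) x =
  avg hit_var x + hit_energy x + 2 * (hit_mean x - (a - 1)) * (avg hit_mean x - hit_mean x)
   + (hit_mean x - (a - 1)) ^+ 2.
  have one z : z = \sum_y trans x y * z by rewrite -mulr_suml trans_sum1 mul1r.
  rewrite [X in avg hit_mean x - X]one [X in _ = _ + X]one.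
  rewrite /avg /hit_energy -sumrB mulr_sumr -!big_split; apply: eq_bigr => y _ /=.
  by ring.
have -> : avg hit_mean x = hit_mean x - 1 by rewrite hm addrK.
by move: (hit_mean x) (avg hit_var x) (hit_energy x) => m v e; rewrite !expr2; lra.
Qed.

(* Chebyshev's inequality for the hitting time of the root, whose mean is
   [hit_mean] and whose variance is at most [hit_var]. *)
Lemma hit_upper_tail N a x : a <= N%:R ->
  surv (pred1 o) N x * (N%:R - a) ^+ 2 <= hit_var x + (hit_mean x - a) ^+ 2.
Proof.
elim: N a x => [|N IH] a x aN; have [->|xo] := eqVneq x o.
- by rewrite surv_in /= ?eqxx // mul0r addr_ge0 ?hit_var_ge0 ?sqr_ge0.
- rewrite surv0 /= xo mul1r; have := hit_var_ge0 x; have := hit_mean_ge0 x.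
  move: (hit_mean x) (hit_var x) aN => m v; rewrite !expr2; nra.
- by rewrite surv_in /= ?eqxx // mul0r addr_ge0 ?hit_var_ge0 ?sqr_ge0.
rewrite survS //; apply: le_trans (hit_step a xo).
rewrite /avg mulr_suml; apply: ler_sum => y _; rewrite -mulrA ler_wpM2l ?trans_ge0 //.
have -> : N.+1%:R - a = N%:R - (a - 1) by rewrite -natr1; ring.
by apply: IH; move: aN; rewrite -natr1; lra.
Qed.

(** The counterpart for early hits. [N] and [a] decrease together, so [a - N] is preserved; at the
    root it remains that $(a-N)^2\le a^2$. *)
Lemma hit_lower_tail N a x : N%:R <= a ->
  (1 - surv (pred1 o) N x) * (a - N%:R) ^+ 2 <= hit_var x + (hit_mean x - a) ^+ 2.
Proof.
elim: N a x => [|N IH] a x aN; have [->|xo] := eqVneq x o.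
- rewrite surv_in /= ?eqxx // /hit_var /hit_mean !potential_root; lra.
- by rewrite surv0 /= xo subrr mul0r addr_ge0 ?hit_var_ge0 ?sqr_ge0.
- rewrite surv_in /= ?eqxx // /hit_var /hit_mean !potential_root.
  move: (ler0n R N.+1) aN; move: (N.+1%:R) => n; rewrite !expr2; nra.
rewrite survS //; apply: le_trans (hit_step a xo).
have -> : 1 - avg (surv (pred1 o) N) x = avg (fun y => 1 - surv (pred1 o) N y) x.
  by rewrite -{1}(trans_sum1 x) /avg -sumrB; apply: eq_bigr => y _; rewrite mulrBr mulr1.
rewrite /avg mulr_suml; apply: ler_sum => y _; rewrite -mulrA ler_wpM2l ?trans_ge0 //.
have -> : a - N.+1%:R = (a - 1) - N%:R by rewrite -natr1; ring.
by apply: IH; move: aN; rewrite -natr1; lra.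
Qed.

(** With [M] the maximum of [hit_mean], the Markov property gives [hit_mean x <= N + M * q]; at a
    maximiser this can be solved for [M]. *)
Lemma hit_mean_le N q : 0 <= q < 1 -> (forall x, surv (pred1 o) N x <= q) ->
  forall x, hit_mean x <= N%:R / (1 - q).
Proof.
move=> /andP[q0 q1] sq.
have [M hM hMx] : exists2 M, forall x, hit_mean x <= M & exists x, hit_mean x = M.
  exists (hit_mean [arg max_(x > o) hit_mean x]%O); last by eexists.
  by case: arg_maxP => // i _ h x; apply: h.
have M0 : 0 <= M by apply: le_trans (hM o); apply: hit_mean_ge0.
have H n x : hit_mean x <= n%:R + M * surv (pred1 o) n x.
  elim: n x => [|n IH] x; have [->|xo] := eqVneq x o.
  - by rewrite /hit_mean potential_root addr_ge0 // mulr_ge0 ?surv_ge0.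
  - by rewrite surv0 /= xo mulr1 add0r.
  - by rewrite /hit_mean potential_root addr_ge0 // mulr_ge0 ?surv_ge0.
  rewrite survS // /hit_mean (potential_solves _ xo) -/hit_mean -natr1.
  apply: le_trans (_ : avg (fun y => M * surv (pred1 o) n y + n%:R) x + 1 <= _).
    by rewrite lerD2r; apply: avg_le => y; rewrite addrC.
  rewrite avgDc [n%:R + 1 + _]addrC addrA lerD2r lerD2r.
  by rewrite /avg mulr_sumr; apply: ler_sum => y _; rewrite mulrCA.
move=> x; apply: le_trans (hM x) _; rewrite ler_pdivlMr ?subr_gt0 //.
case: hMx => z hz; have := H N z; rewrite hz; have := ler_wpM2l M0 (sq z); lra.
Qed.

(** * The variance of the hitting time *)

Section Variance.
Variable lam : R.
Hypothesis lam0 : 0 <= lam.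
Hypothesis lam1 : lam < 1.
Hypothesis gap : forall g : C -> R, mean g = 0 -> dot (avg g) g <= lam * dot g g.
Hypothesis heavy : forall v : C, v != o -> mass (under v) <= 2^-1.

(** On the subtree [W] let [g] be the mean time to reach the parent of [y], extended by 0. Twice its
    Dirichlet form dominates the flow of [hit_energy]; the form itself equals [mean g], since
    [g - avg g] is 1 on [W]. The gap and Cauchy-Schwarz then give
    [(1 - lam) * mean g <= 2 * mass W]. *)
Lemma flow_energy_le y : y != o -> flow hit_energy y <= 4 / (1 - lam) * mass (under y).
Proof.
move=> yo; set W := under y; set m := hit_mean.
pose g z := (W z)%:R * (m z - m (par y)).
(* A step from [W] stays in [W] or leads to the parent of [y], where both sides vanish. *)
have nb z w : W z -> trans z w != 0 -> g w = m w - m (par y).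
  move=> Wz tzw; rewrite /g; have [Ww|nWw] := boolP (W w); first by rewrite mul1r.
  suff -> : w = par y by rewrite subrr mulr0.
  have [wz|wz] := eqVneq w z; first by rewrite wz Wz in nWw.
  have Ezw : E z w by apply: contraNT tzw => /trans_nonedge ->.
  have [[zo e]|[wo e]] := edge_parent Et o Ezw.
    move: Wz; rewrite /W anc_step -e => /orP[/eqP <- //|Ww].
    by rewrite /W Ww in nWw.
  by move: nWw; rewrite /W anc_step -e -/(W z) Wz orbT.
have gz z : W z -> g z = m z - m (par y) by rewrite /g => ->; rewrite mul1r.
have e1 : flow hit_energy y <= 2 * (dot g g - dot (avg g) g).
  rewrite dirichlet //.
  rewrite /flow big_mkcond /=; apply: ler_sum => z _; case: ifP => Wz; last first.
    by apply: sumr_ge0 => w _; rewrite mulr_ge0 ?sqr_ge0 // mulr_ge0 ?stat_ge0 ?trans_ge0.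
  rewrite /hit_energy mulr_sumr; apply: ler_sum => w _; rewrite mulrA.
  have [->|tzw] := eqVneq (trans z w) 0; first by rewrite mulr0 !mul0r.
  by rewrite (nb z w) // gz // -/m opprB addrA subrK.
have e2 : dot g g - dot (avg g) g = mean g.
  rewrite /dot -sumrB; apply: eq_bigr => z _; rewrite -mulrBr -mulrBl; congr (_ * _).
  have [Wz|nWz] := boolP (W z); last by rewrite /g (negbTE nWz) mul0r mulr0.
  have zo : z != o.
    by apply/eqP => e; move: Wz; rewrite /W e anc_root eq_sym (negbTE yo).
  suff -> : avg g z = g z - 1 by rewrite opprB addrC subrK mul1r.
  have -> : avg g z = avg (fun w => m w + - m (par y)) z.
    apply: eq_bigr => w _; have [->|tzw] := eqVneq (trans z w) 0; first by rewrite !mul0r.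
    by rewrite (nb z w).
  by rewrite avgDc gz // [m z in RHS]/m /hit_mean (potential_solves _ zo) -/hit_mean -/m; ring.
have g0 z : 0 <= g z.
  rewrite /g; have [Wz|] := boolP (W z); last by rewrite mul0r.
  rewrite mul1r subr_ge0; rewrite /W in Wz.
  move: Wz; elim/(depth_ind (Etree := Et) (o := o)): z => [|z zo IH].
    by rewrite anc_root eq_sym (negbTE yo).
  have st u : u != o -> m (par u) <= m u.
    move=> uo; have := potential_step (fun=> 1) uo; rewrite -/hit_mean -/m => h.
    rewrite -subr_ge0 -(pmulr_lge0 _ (cond_gt0 uo)) h.
    by apply: sumr_ge0 => w _; rewrite mulr1 stat_ge0.
  rewrite anc_step => /orP[/eqP -> | /IH h]; first exact: st.
  exact: le_trans h (st _ zo).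
have mg0 : 0 <= mean g by apply: sumr_ge0 => z _; rewrite mulr_ge0 ?stat_ge0.
have gsupp x : predC W x -> g x = 0 by rewrite /g /= => /negbTE ->; rewrite mul0r.
have := mean_supp_sq gsupp; rewrite massC opprB addrC subrK => cs.
have gp := avg_gap gap g; have hv := heavy yo; rewrite -/W in hv.
have mW0 := mass_ge0 W; have dg0 := dot_ge0 g.
have l1 : 0 < 1 - lam by rewrite subr_gt0.
(* As [W] has mass at most 1/2, the squared mean of [g] is at most half of [dot g g], and the gap
   inequality survives with a factor 2. *)
have k1 : (1 - lam) * dot g g <= 2 * mean g.
  have : (1 - lam) * (dot g g - mean g ^+ 2) <= mean g.
    by move: gp e2; move: (dot g g) (dot (avg g) g) (mean g) => d1 d2 mu; lra.
  have : dot g g / 2 <= dot g g - mean g ^+ 2.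
    by move: cs hv dg0; move: (dot g g) (mean g ^+ 2) (mass W) => d1 d2 mu; nra.
  move=> /(ler_wpM2l (ltW l1)) h1 /(le_trans h1); lra.
have k2 : (1 - lam) * mean g ^+ 2 <= 2 * mass W * mean g.
  apply: le_trans (ler_wpM2l (ltW l1) cs) _; rewrite mulrA.
  by apply: le_trans (ler_wpM2r mW0 k1) _; rewrite mulrAC.
have k3 : (1 - lam) * mean g <= 2 * mass W.
  have [->|mgn] := eqVneq (mean g) 0; first by rewrite mulr0 mulr_ge0.
  have mgp : 0 < mean g by rewrite lt_def mgn.
  by rewrite -(ler_pM2r mgp) -mulrA -expr2.
apply: le_trans e1 _; rewrite e2 mulrAC ler_pdivlMr //.
by move: k3; move: (mean g) (mass W) => d1 d2; lra.
Qed.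

Lemma hit_var_le x : hit_var x <= 4 / (1 - lam) * hit_mean x.
Proof.
rewrite /hit_mean -potentialZ; apply: potential_le => y yo.
apply: le_trans (flow_energy_le yo) _; rewrite /flow /mass mulr_sumr.
by rewrite le_eqVlt; apply/orP; left; apply/eqP/eq_bigr => z _; rewrite mulr1 mulrC.
Qed.

End Variance.
End TreeChain.

(** * The second eigenvalue *)

Section Eigenvalues.
Variables (R : realType) (C : markovChain R) (E : rel C).
Hypothesis Et : is_tree E.
Hypothesis lzE : lazy_on E.
Hypothesis rev : reversible C.
Hypothesis C2 : (2 <= #|C|)%N.

Let lz (x : C) : 2^-1 <= trans x x. Proof. exact: lzE.2. Qed.
Let pi0 (x : C) : 0 < stat x := stat_gt0 Et lzE rev x.

Lemma dot_gt0 (f : C -> R) x : f x != 0 -> 0 < dot f f.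
Proof.
move=> fx; rewrite /dot (bigD1 x) //= ltr_wpDr //.
  by apply: sumr_ge0 => y _; rewrite mulr_ge0 ?stat_ge0 // -expr2 sqr_ge0.
by rewrite mulr_gt0 // -expr2 exprn_even_gt0.
Qed.

(** The Dirichlet form of [f] vanishes, hence so does its increment along every edge. *)
Lemma harmonic_cst (f : C -> R) : avg f = f -> forall x y, f x = f y.
Proof.
move=> hf.
have : \sum_x \sum_y stat x * trans x y * (f y - f x) ^+ 2 = 0.
  by rewrite -dirichlet // hf subrr mulr0.
have ge0 x y : 0 <= stat x * trans x y * (f y - f x) ^+ 2.
  by rewrite mulr_ge0 ?sqr_ge0 // mulr_ge0 ?stat_ge0 ?trans_ge0.
move=> /eqP; rewrite psumr_eq0 => [/allP z0|x _]; last exact: sumr_ge0.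
have edge x y : E x y -> f x = f y.
  move=> xy; have := z0 x (mem_index_enum _); rewrite /= psumr_eq0 //.
  move=> /allP/(_ y (mem_index_enum _)) /=.
  rewrite mulf_eq0 sqrf_eq0 mulf_eq0 gt_eqF //= gt_eqF ?(trans_edge lzE) //= subr_eq0.
  by move=> /eqP.
move=> x y; elim/(depth_ind (Etree := Et) (o := y)): x => // x xy <-.
by apply: edge; case: (parentP Et xy).
Qed.

Let n := #|C|.
Let e (i : 'I_n) : C := enum_val i.
Let r (x : C) : R := Num.sqrt (stat x).

Let r0 x : 0 < r x. Proof. by rewrite sqrtr_gt0. Qed.
Let rn0 x : r x != 0. Proof. by rewrite gt_eqF. Qed.
Let rr x : r x * r x = stat x. Proof. by rewrite -expr2 sqr_sqrtr ?stat_ge0. Qed.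

Let sumE (F : C -> R) : \sum_(i < n) F (e i) = \sum_(x : C) F x.
Proof. by rewrite -(big_enum_val F); apply: eq_bigl. Qed.

(** Conjugation of the transition matrix by the diagonal matrix of square roots of [stat], symmetric
    by reversibility. [vec] is the matching isometry from functions with [dot] to column vectors,
    and [fct] its inverse. *)
Let A : 'M[R]_n := \matrix_(i, j) (r (e i) * trans (e i) (e j) / r (e j)).
Let psi : 'cV[R]_n := \col_i r (e i).
Let vec (f : C -> R) : 'cV[R]_n := \col_i (r (e i) * f (e i)).
Let fct (v : 'cV[R]_n) (x : C) : R := v (enum_rank x) 0 / r x.

Let fctK v : vec (fct v) = v.
Proof. by apply/colP => i; rewrite mxE /fct /e enum_valK mulrC divfK. Qed.

Let A_vec f : A *m vec f = vec (avg f).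
Proof.
apply/colP => i; rewrite !mxE /avg mulr_sumr -(sumE (fun y => r (e i) * (trans (e i) y * f y))).
by apply: eq_bigr => j _; rewrite !mxE; field.
Qed.

Let vec_inj f g : vec f = vec g -> f = g.
Proof.
move=> /colP h; apply/funext => x; have := h (enum_rank x).
by rewrite !mxE /e enum_rankK => /(mulfI (rn0 x)).
Qed.

Let vecZ a f : a *: vec f = vec (fun x => a * f x).
Proof. by apply/colP => i; rewrite !mxE mulrCA. Qed.

Let vec_dot f g : ((vec f)^T *m vec g) 0 0 = dot f g.
Proof.
rewrite mxE /dot -sumE; apply: eq_bigr => i _; rewrite !mxE -rr; ring.
Qed.

Let psiE : psi = vec (fun=> 1).
Proof. by apply/colP => i; rewrite !mxE mulr1. Qed.

Let A_sym : A^T = A.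
Proof.
apply/matrixP => i j; rewrite !mxE; set x := e i; set y := e j.
apply: (mulfI (rn0 x)); apply: (mulfI (rn0 y)).
transitivity (stat y * trans y x); first by rewrite -rr; field.
by rewrite -rev -rr; field.
Qed.

Let psi_norm : psi^T *m psi = 1%:M.
Proof.
rewrite [LHS]mx11_scalar psiE vec_dot /dot; congr (_ %:M).
by rewrite -[RHS](stat_sum1 C); apply: eq_bigr => x _; rewrite !mulr1.
Qed.

Let A_psi : A *m psi = psi.
Proof. by rewrite psiE A_vec avg_cst. Qed.

Let A_simple (v : 'cV[R]_n) : A *m v = v -> exists c, v = c *: psi.
Proof.
rewrite -{1 2}(fctK v) A_vec => /vec_inj /harmonic_cst h.
have [x0 _] : exists x0 : C, true.
  by case: (pickP (fun _ : C => true)) => [x _|/eq_card0 c0]; [exists x | move: C2; rewrite c0].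
exists (fct v x0); rewrite psiE vecZ -[LHS]fctK; congr vec; apply/funext => x.
by rewrite mulr1.
Qed.

Let vec_neq0 (v : 'cV[R]_n) : v != 0 -> exists x, fct v x != 0.
Proof.
move=> v0; have [/existsP//|/existsPn h] := boolP [exists x, fct v x != 0].
case/eqP: v0; rewrite -(fctK v); apply/colP => i; rewrite !mxE.
by have /negPn/eqP -> := h (e i); rewrite mulr0.
Qed.

Let A_le1 (v : 'cV[R]_n) a : A *m v = a *: v -> v != 0 -> a <= 1.
Proof.
move=> + /vec_neq0 [x fx].
rewrite -{1 2}(fctK v) A_vec vecZ => /vec_inj h.
have d0 := dot_gt0 fx; rewrite -(ler_pM2r d0) mul1r.
have -> : a * dot (fct v) (fct v) = dot (avg (fct v)) (fct v).
  by rewrite h /dot mulr_sumr; apply: eq_bigr => y _; ring.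
rewrite -subr_ge0 -(pmulr_rge0 _ (_ : 0 < (2 : R))) // dirichlet //.
apply: sumr_ge0 => z _; apply: sumr_ge0 => w _.
by rewrite mulr_ge0 ?sqr_ge0 // mulr_ge0 ?stat_ge0 ?trans_ge0.
Qed.

Let char_A : char_poly (trans_mx C) = char_poly A.
Proof.
apply: (@char_poly_similar _ _ _ _ (diag_mx (\row_i r (e i)))).
  rewrite unitmxE det_diag unitfE; apply/prodf_neq0 => i _; by rewrite mxE.
apply/matrixP => i j; rewrite mul_diag_mx mul_mx_diag !mxE; rewrite divfK //.
Qed.

(** A real symmetric matrix has a split characteristic polynomial, which rules out the default value
    of [xget]. *)
Lemma eigenvaluesP : sorted >=%R (eigenvalues C) /\
  char_poly A = \prod_(a <- eigenvalues C) ('X - a%:P).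
Proof.
rewrite -char_A /eigenvalues; case: xgetP => [s -> //|none].
have [d [_ [_ [_ _ _ _ ch]]]] := real_symmetric_spectral A_sym.
exfalso; apply: (none (sort >=%R [seq d 0 k | k <- enum 'I_n])); split.
  by apply: sort_sorted => a b; apply: le_total.
rewrite char_A ch (perm_big [seq d 0 k | k <- enum 'I_n]) ?perm_sort //=.
by rewrite big_map big_enum.
Qed.

Let second : lambda2 C < 1 /\ forall v : 'cV_n, psi^T *m v = 0 ->
  (v^T *m A *m v) 0 0 <= lambda2 C * (v^T *m v) 0 0.
Proof.
have [srt ch] := eigenvaluesP.
exact: symmetric_second_eigenvalue A_sym psi_norm A_psi A_simple A_le1 C2 srt ch.
Qed.

Lemma lambda2_lt1 : lambda2 C < 1.
Proof. exact: second.1. Qed.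

Lemma lambda2_gap (g : C -> R) : mean g = 0 -> dot (avg g) g <= lambda2 C * dot g g.
Proof.
move=> g0; have := second.2 (vec g).
rewrite -mulmxA A_vec !vec_dot dotC; apply.
apply/matrixP => i j; rewrite !ord1 psiE vec_dot mxE -g0.
by apply: eq_bigr => x _; rewrite mul1r.
Qed.

(** The mean vanishes because stationarity gives [mean f = lambda2 C * mean f] with [lambda2 C]
    different from 1. *)
Lemma lambda2_eigenfunction : exists f : C -> R,
  [/\ exists x, f x != 0, avg f = (fun x => lambda2 C * f x) & mean f = 0].
Proof.
have [srt ch] := eigenvaluesP.
have l2in : lambda2 C \in eigenvalues C.
  apply: mem_nth; have := congr1 (fun p : {poly R} => size p) ch.
  by rewrite size_char_poly size_prod_XsubC => -[<-].
have /eigenvalueP [v vA v0] : eigenvalue A (lambda2 C).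
  by rewrite eigenvalue_root_char ch root_prod_XsubC.
have v0' : v^T != 0 by apply: contra_neq v0 => /(congr1 trmx); rewrite trmxK trmx0.
have Av : A *m v^T = lambda2 C *: v^T by rewrite -{1}A_sym -trmx_mul vA linearZ.
have avf : avg (fct v^T) = (fun x => lambda2 C * fct v^T x).
  by apply: vec_inj; rewrite -A_vec -vecZ fctK.
exists (fct v^T); split=> //; first exact: vec_neq0.
have := mean_avg (fct v^T); rewrite avf meanZ => /eqP.
rewrite -subr_eq0 -[X in _ - X]mul1r -mulrBl mulf_eq0 subr_eq0.
by rewrite lt_eqF ?lambda2_lt1 //= => /eqP.
Qed.

Lemma lambda2_ge0 : 0 <= lambda2 C.
Proof.
have [f [[x fx] avf _]] := lambda2_eigenfunction.
have := avg_psd rev lz f; rewrite avf.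
have -> : dot (fun x => lambda2 C * f x) f = lambda2 C * dot f f.
  by rewrite /dot mulr_sumr; apply: eq_bigr => y _; ring.
by rewrite pmulr_lge0 // (dot_gt0 fx).
Qed.

End Eigenvalues.

(** * Mixing times *)

Lemma nat_ceil (R : realType) (z : R) : 0 <= z -> exists n : nat, z <= n%:R <= z + 1.
Proof.
move=> z0; exists (Num.truncn z).+1.
have /andP[h1 h2] := truncn_itv z0; rewrite (ltW h2) -natr1 lerD2r h1 //.
Qed.

(** At $y=\epsilon^{-1/2}$ it reads $e^{-y}\le\epsilon$; the proof squares $y\le 2e^{y/2-1}\le
    e^{y/2}$. *)
Lemma expR_ge_sqr (R : realType) (y : R) : 0 <= y -> y ^+ 2 <= expR y.
Proof.
move=> y0.
have h : y <= expR (y / 2).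
  have -> : y / 2 = 1 + (y / 2 - 1) by ring.
  rewrite expRD; have h1 := expR_ge1Dx (y / 2 - 1); have h2 := expR_ge1Dx (1 : R).
  have := expR_ge0 (y / 2 - 1); move: (expR (y / 2 - 1)) (expR 1) h1 h2 => a b h1 h2 h3.
  apply: le_trans (_ : 2 * a <= _); first by move: h1; lra.
  by rewrite ler_wpM2r //; move: h2; lra.
have -> : y = y / 2 + y / 2 by field.
rewrite expRD -expr2; have -> : y / 2 + y / 2 = y by field.
by rewrite lerXn2r // nnegrE ?expR_ge0.
Qed.

Lemma pow1B_le (R : realType) (y b : R) n k : 0 < y -> 0 <= 1 - b -> k%:R * y <= n%:R * b ->
  (1 - b) ^+ n <= (y ^+ 2)^-1 ^+ k.
Proof.
move=> y0 b1 kb; apply: le_trans (_ : expR (- b) ^+ n <= _).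
  by rewrite lerXn2r ?nnegrE ?expR_ge0 // expR_ge1Dx.
rewrite -expRM_natl; apply: le_trans (_ : expR (- y) ^+ k <= _).
  by rewrite -expRM_natl ler_expR !mulrN lerN2.
rewrite lerXn2r ?nnegrE ?expR_ge0 ?invr_ge0 ?sqr_ge0 //.
by rewrite expRN lef_pV2 ?posrE ?expR_gt0 ?exprn_gt0 // expR_ge_sqr // ltW.
Qed.

Section Mixing.
Variables (R : realType) (C : markovChain R).
Implicit Types (f g : C -> R) (A B D G K : pred C).

Lemma iter_avg_cst n (a : R) : iter n avg (fun=> a) = (fun=> a) :> (C -> R).
Proof. by elim: n => //= n ->; apply: avg_cst. Qed.

Lemma trans_iter_sum1 t (x : C) : \sum_(y : C) trans_iter t x y = 1.
Proof.
have := trans_iterE t (fun=> 1) x; rewrite iter_avg_cst => <-.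
by apply: eq_bigr => y _; rewrite mulr1.
Qed.

Lemma tv_distE t (x : C) : let D y := trans_iter t x y - stat y in
  tv_dist (trans_iter t x) (@stat R C) = \sum_(y : C) ((0 <= D y)%R)%:R * D y.
Proof.
move=> D; have D0 : \sum_y D y = 0 by rewrite sumrB trans_iter_sum1 stat_sum1 subrr.
have -> : tv_dist (trans_iter t x) (@stat R C) =
    \sum_y ((0 <= D y)%R)%:R * D y - 2^-1 * \sum_y D y; last by rewrite D0 mulr0 subr0.
rewrite /tv_dist !mulr_sumr -sumrB; apply: eq_bigr => y _; rewrite -/(D y).
by have [h|h] := lerP 0 (D y); rewrite /= ?mulr1n ?mulr0n
  ?(ger0_norm h) ?(ltr0_norm h); move: (D y) h => d; lra.
Qed.

Lemma tv_dist_le t (x : C) eps :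
  (forall A, iter t avg (fun y => (A y)%:R - mass A) x <= eps) ->
  tv_dist (trans_iter t x) (@stat R C) <= eps.
Proof.
(* The event that the law at time [t] is at least [stat] attains the total variation distance. *)
move=> h; rewrite tv_distE; set A := fun y => 0 <= trans_iter t x y - stat y.
apply: le_trans (h A); rewrite -trans_iterE le_eqVlt; apply/orP; left; apply/eqP.
under [RHS]eq_bigr do rewrite mulrBr.
rewrite sumrB -mulr_suml trans_iter_sum1 mul1r -mean_indic /mean -sumrB.
by apply: eq_bigr => y _; rewrite -/(A y); ring.
Qed.

Lemma iter_avg_le_tv t (x : C) g : (forall y, 0 <= g y <= 1) ->
  iter t avg g x <= mean g + tv_dist (trans_iter t x) (@stat R C).
Proof.
move=> g01; rewrite tv_distE -trans_iterE /mean -big_split; apply: ler_sum => y _ /=.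
have /andP[g0 g1] := g01 y; move: (trans_iter t x y) (stat y) (g y) g0 g1 => p q w g0 g1.
have [h|h] := lerP 0 (p - q); rewrite ?mul1r ?mul0r; nra.
Qed.

Lemma mix_dist_leP t eps : 0 <= eps ->
  mix_dist C t <= eps <-> forall x : C, tv_dist (trans_iter t x) (@stat R C) <= eps.
Proof.
move=> e0; split=> [h x|h]; last by apply: bigmax_le.
apply: le_trans h; exact: le_bigmax.
Qed.

Lemma tv_le_mix_dist t (x : C) : tv_dist (trans_iter t x) (@stat R C) <= mix_dist C t.
Proof. exact: le_bigmax. Qed.

Lemma t_mixP eps : (exists t, mix_dist C t <= eps) ->
  exists n : nat, [/\ t_mix C eps = n%:R, mix_dist C n <= eps
    & forall m, mix_dist C m <= eps -> (n <= m)%N].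
Proof.
move=> ex; case: (ex_minnP ex) => n hn nmin; exists n; split=> //.
rewrite /t_mix; apply/eqP; rewrite eq_le; apply/andP; split.
  apply: ge_inf; last by exists n.
  by exists 0 => _ [m _ <-]; exact: ler0n.
apply: lb_le_inf; first by exists n%:R; exists n.
by move=> _ [m hm <-]; rewrite ler_nat nmin.
Qed.

Section Spectral.
Hypothesis rev : reversible C.
Hypothesis lz : forall x : C, 2^-1 <= trans x x.
Hypothesis spos : forall x : C, 0 < stat x.
Variable lam : R.
Hypothesis lam0 : 0 <= lam.
Hypothesis lam1 : lam < 1.
Hypothesis gap : forall g, mean g = 0 -> dot (avg g) g <= lam * dot g g.

Lemma mean_centered A : mean (fun y => (A y)%:R - mass A) = 0.
Proof. by rewrite meanD mean_cst mean_indic subrr. Qed.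

Lemma dot_centered_le A :
  dot (fun y => (A y)%:R - mass A) (fun y => (A y)%:R - mass A) <= 4^-1.
Proof.
have -> : dot (fun y => (A y)%:R - mass A) (fun y => (A y)%:R - mass A)
  = mean (fun y => (1 - 2 * mass A) * (A y)%:R + mass A ^+ 2).
  by apply: eq_bigr => y _; case: (A y); rewrite /= ?mulr1n ?mulr0n; ring.
rewrite meanD meanZ mean_indic mean_cst; have := sqr_ge0 (2 * mass A - 1).
by move: (mass A) => a; rewrite !expr2; lra.
Qed.

(** Ensures that every mixing time is an infimum over a nonempty set. The least mass [c] of a state
    turns the decay of the norm into pointwise decay. *)
Lemma mix_dist_small eps : 0 < eps -> exists t, mix_dist C t <= eps.
Proof.
move=> e0.
have [c c0 hc] : exists2 c : R, 0 < c & forall x : C, c <= stat x.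
  have [x0 _] : exists x0 : C, true.
    case: (pickP (fun _ : C => true)) => [x _|none]; first by exists x.
    have := stat_sum1 C; rewrite big1 => [/esym/eqP|x]; first by rewrite oner_eq0.
    by have := none x.
  exists (stat [arg min_(x < x0) (stat x : R)]%O) => // x.
  by case: arg_minP => // i _; apply.
have l0 : 0 < 1 - lam by rewrite subr_gt0.
(* Chosen so that $\lambda^n\le e^{-(1-\lambda)n}\le c\epsilon^2$, by $e^x\ge 1+x$. *)
have [n /andP[hn _]] : exists n : nat,
    (c * eps ^+ 2)^-1 / (1 - lam) <= n%:R <= (c * eps ^+ 2)^-1 / (1 - lam) + 1.
  by apply: nat_ceil; rewrite divr_ge0 ?invr_ge0 ?mulr_ge0 ?sqr_ge0 // ltW.
have ce0 : 0 < c * eps ^+ 2 by rewrite mulr_gt0 ?exprn_gt0.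
have ln : lam ^+ n <= c * eps ^+ 2.
  apply: le_trans (_ : expR (- (1 - lam)) ^+ n <= _).
    by rewrite lerXn2r ?nnegrE ?expR_ge0 //; have := expR_ge1Dx (- (1 - lam)); lra.
  rewrite -expRM_natl mulrN expRN -[leRHS]invrK lef_pV2 ?posrE ?expR_gt0 ?invr_gt0 //.
  apply: le_trans (expR_ge1Dx _); move: hn; rewrite ler_pdivrMr //; lra.
exists n; apply/mix_dist_leP; first exact: ltW.
move=> x; apply: tv_dist_le => A; set f := fun y => _.
have f0 : mean f = 0 := mean_centered A.
have fn := dot_iter_avg_le rev lz lam0 gap f0 (n + n).
have u2 : c * (iter n avg f x) ^+ 2 <= dot (iter (n + n) avg f) f.
  rewrite -(dot_iterD (avg_selfadjoint rev)) /dot (bigD1 x) //=.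
  apply: le_trans (_ : stat x * (iter n avg f x * iter n avg f x) <= _).
    by rewrite -expr2 ler_wpM2r ?sqr_ge0.
  by rewrite lerDl sumr_ge0 // => y _; rewrite mulr_ge0 ?stat_ge0 // -expr2 sqr_ge0.
have l2 : lam ^+ (n + n) * dot f f <= c * eps ^+ 2.
  have ln1 : lam ^+ n <= 1 by apply: exprn_ile1 => //; apply: ltW.
  have ln0 : 0 <= lam ^+ n by apply: exprn_ge0.
  have d1 := dot_centered_le A; rewrite -/f in d1; have d0 := dot_ge0 f.
  rewrite exprD; apply: le_trans ln; rewrite -mulrA ler_piMr //.
  apply: le_trans (_ : 1 * 1 <= _); last by rewrite mulr1.
  by apply: ler_pM => //; apply: le_trans d1 _; lra.
have : (iter n avg f x) ^+ 2 <= eps ^+ 2.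
  by rewrite -(ler_pM2l c0); apply: le_trans u2 (le_trans fn l2).
have [h _|h] := lerP (iter n avg f x) 0; first by apply: le_trans h (ltW e0).
by rewrite ler_sqr ?nnegrE // ltW.
Qed.

End Spectral.
End Mixing.

(** * The window on trees *)

Section TreeMixing.
Variables (R : realType) (C : markovChain R) (E : rel C).
Hypothesis Et : is_tree E.
Hypothesis lzE : lazy_on E.
Hypothesis rev : reversible C.
Hypothesis C2 : (2 <= #|C|)%N.

Let Esym : symmetric E. Proof. by case: Et. Qed.
Let lz (x : C) : 2^-1 <= trans x x. Proof. exact: lzE.2. Qed.
Let lam := lambda2 C.
Let T := t_rel C.
Let lam0 : 0 <= lam. Proof. exact: lambda2_ge0 Et lzE rev C2. Qed.
Let lam1 : lam < 1. Proof. exact: lambda2_lt1 Et lzE rev C2. Qed.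
Let gap (g : C -> R) : mean g = 0 -> dot (avg g) g <= lam * dot g g.
Proof. exact: lambda2_gap Et lzE rev C2 g. Qed.
Let spos (x : C) : 0 < stat x. Proof. exact: stat_gt0 Et lzE rev x. Qed.

Lemma t_rel_ge1 : 1 <= t_rel C.
Proof.
by rewrite /t_rel -/lam -[leLHS]invr1 lef_pV2 ?posrE ?subr_gt0 // gerBl.
Qed.

Let T0 : 0 < T. Proof. exact: lt_le_trans ltr01 t_rel_ge1. Qed.
Let TV : 1 - lam = T^-1. Proof. by rewrite /T /t_rel invrK. Qed.

(** At a maximum of $|f|$, for an eigenfunction $f$ of mean zero, distance at most 1/4 forces
    $\lambda^t\le 1/2$; Bernoulli's inequality $\lambda^t\ge 1-t(1-\lambda)$ does the rest. *)
Lemma t_rel_le_mix t : mix_dist C t <= 4^-1 -> T <= 2 * t%:R.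
Proof.
move=> mt; have [f [[x0 fx0] avf mf]] := lambda2_eigenfunction Et lzE rev C2.
have [x fx] : exists x, forall y, `|f y| <= `|f x|.
  exists [arg max_(x > x0) `|f x|]%O => y.
  by case: arg_maxP => // i _; apply.
have nfx : 0 < `|f x| by apply: lt_le_trans (fx x0); rewrite normr_gt0.
have itE n : iter n avg f = (fun y => lam ^+ n * f y).
  elim: n => [|n IH]; first by apply/funext => y; rewrite mul1r.
  rewrite iterS IH; apply/funext => y; rewrite exprSr -mulrA.
  have -> : lam * f y = avg f y by rewrite avf.
  by rewrite /avg mulr_sumr; apply: eq_bigr => z _; rewrite mulrCA.
have h1 : lam ^+ t * `|f x| <= 2^-1 * `|f x|.
  have -> : lam ^+ t * `|f x| = `|\sum_y (trans_iter t x y - stat y) * f y|.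
    under eq_bigr do rewrite mulrBl.
    rewrite sumrB trans_iterE -/(mean f) mf subr0 itE normrM ger0_norm //.
    exact: exprn_ge0.
  apply: le_trans (ler_norm_sum _ _ _) _.
  apply: le_trans (_ : \sum_y `|trans_iter t x y - stat y| * `|f x| <= _).
    by apply: ler_sum => y _; rewrite normrM ler_wpM2l.
  rewrite -mulr_suml ler_wpM2r //.
  have := le_trans (tv_le_mix_dist t x) mt; rewrite /tv_dist.
  by move: (\sum_y _) => S; lra.
move: h1; rewrite ler_pM2r // => h1.
have bern n : 1 - n%:R * (1 - lam) <= lam ^+ n.
  elim: n => [|n IH]; first by rewrite mul0r subr0.
  rewrite exprS -natr1; have := ler_wpM2l lam0 IH.
  have := mulr_ge0 (ler0n R n) (sqr_ge0 (1 - lam)).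
  by move: (n%:R) (lam ^+ n) lam => n' p l; rewrite !expr2; lra.
have := le_trans (bern t) h1; rewrite TV => h2.
have : 2^-1 <= t%:R / T by lra.
by rewrite ler_pdivlMr //; lra.
Qed.

(** * Components around the centroid *)

Variable o : C.
Hypothesis heavy : forall v : C, v != o -> mass (fun z : C => anc Et o z v) <= 2^-1.

(** Encodes a union of components of the tree without [o]. *)
Definition closed_off (B : pred C) :=
  ~~ B o /\ forall y z, B y -> E y z -> z != o -> B z.

Lemma component x : x != o -> exists B : pred C, [/\ B x, closed_off B & mass B <= 2^-1].
Proof.
move=> xo; have [c [co pc xc]] := top_child Et xo.
exists (fun z : C => anc Et o z c); split; [exact: xc | split | exact: heavy].
  by rewrite anc_root eq_sym.
by move=> y z yc Eyz zo; apply: (anc_closed co pc yc Eyz zo).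
Qed.

Lemma closed_avg (B : pred C) (f g : C -> R) x : closed_off B -> B x ->
  (forall y, B y || (y == o) -> f y <= g y) -> avg f x <= avg g x.
Proof.
move=> [_ cB] Bx fg; apply: ler_sum => y _.
have [yx|yx] := eqVneq y x; first by rewrite ler_wpM2l ?trans_ge0 // fg // yx Bx.
have [Exy|nE] := boolP (E x y); last by rewrite (trans_nonedge lzE nE yx) !mul0r.
rewrite ler_wpM2l ?trans_ge0 // fg //; have [_|yo] := eqVneq y o; first exact: orbT.
by rewrite (cB x y).
Qed.

(** As long as the chain avoids [o] it cannot leave [B]. *)
Lemma surv_component (B : pred C) n x : closed_off B -> B x ->
  surv (pred1 o) n x <= surv (predC B) n x.
Proof.
move=> cB; elim: n x => [|n IH] x Bx.
  by rewrite !surv0 /= Bx /= lern1; case: (x == o).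
have xo : x != o by apply/eqP => e; case: cB => + _; rewrite -e Bx.
rewrite !survS //= ?negbK //; apply: closed_avg cB Bx _ => y /orP[/IH //|/eqP ->].
by rewrite surv_in /= ?eqxx // surv_ge0.
Qed.

(** A step from [D] leads into [D] or to [o], never directly into the target; the induction gives
    [o] one step less, which only raises its survival probability. *)
Lemma surv_from_closed (D G : pred C) n z : closed_off D -> D z ->
  surv (fun y => G y && ~~ D y) n o <= surv (fun y => G y && ~~ D y) n z.
Proof.
move=> cD; set G' := fun y => _.
elim: n z => [|n IH] z Dz; have nG : ~~ G' z by rewrite /G' Dz andbF.
  by rewrite [leRHS]surv0 nG surv_le1.
rewrite [leRHS]survS //; apply: le_trans (survS_le _ _ _) _.
rewrite -[leLHS](_ : avg (fun=> surv G' n o) z = _); last by rewrite avg_cst.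
by apply: closed_avg cD Dz _ => y /orP[/IH //|/eqP ->].
Qed.

(** While [D] has mass above 1/2, split off a component, of mass at most 1/2. If it has mass at
    least 1/4 it is the answer; otherwise more than 1/4 remains and [D] has shrunk. *)
Lemma closed_medium (D : pred C) : closed_off D -> 4^-1 <= mass D ->
  exists2 D' : pred C, closed_off D' & 4^-1 <= mass D' <= 2^-1.
Proof.
have [n] := ubnP #|D|; elim: n D => // n IH D Dn [Do cD] Dq.
have [Dh|Dh] := lerP (mass D) 2^-1; first by exists D; rewrite ?Dq.
have [z Dz] : exists z, D z.
  case: (pickP D) => [z|D0]; first by exists z.
  by move: Dq; rewrite /mass (eq_bigl _ _ D0) big_pred0_eq invr_le0 lern0.
have zo : z != o by apply: contraNneq Do => <-.
have [B [Bz [Bo cB] Bh]] := component zo.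
have cDB : closed_off (fun y => D y && B y).
  split; first by rewrite (negbTE Do).
  by move=> y w /andP[Dy By] yw wo; rewrite (cD y w) // (cB y w).
have cDnB : closed_off (fun y => D y && ~~ B y).
  split; first by rewrite (negbTE Do).
  move=> y w /andP[Dy nBy] yw wo; rewrite (cD y w) //=; apply: contra nBy => Bw.
  by apply: (cB w y) => //; [rewrite Esym | apply: contraNneq Do => <-].
have [q|q] := lerP 4^-1 (mass (fun y => D y && B y)).
  exists (fun y => D y && B y) => //; rewrite q; apply: le_trans Bh.
  by apply: mass_sub => y /andP[].
have eD : mass D = mass (fun y => D y && B y) + mass (fun y => D y && ~~ B y).
  by rewrite /mass (bigID B).
apply: (IH (fun y => D y && ~~ B y)) => //; last by move: eD Dh q; lra.
rewrite ltnS in Dn; apply: leq_trans Dn; rewrite -(cardID B D).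
rewrite (eq_card (B := [predD D & B])) => [|y]; last by rewrite !unfold_in /= andbC.
rewrite -[X in (X < _)%N]add0n ltn_add2r; apply/card_gt0P.
by exists z; rewrite !unfold_in /= Dz Bz.
Qed.

(* To leave [D] for the part of [G] outside [K] the chain has to go through
   [o], so starting from [o] is at least as good as starting from [D]. *)
Lemma separating_sets : exists D K : pred C, [/\ 4^-1 <= mass D, mass K <= 2^-1
  & forall (G : pred C) n z, D z ->
      surv (fun y => G y && ~~ K y) n o <= surv (fun y => G y && ~~ K y) n z].
Proof.
(* A root of mass at least 1/4 serves as [D] itself; otherwise its complement has mass above 3/4 and
   contains a suitable union of components. *)
have [so|so] := lerP 4^-1 (stat o).
  exists (pred1 o), pred0; split.
  - by rewrite /mass big_pred1_eq.
  - by rewrite /mass big_pred0_eq invr_ge0.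
  - by move=> G n z /eqP ->.
have co : closed_off (predC1 o) by split; rewrite /= ?eqxx.
have : 4^-1 <= mass (predC1 o).
  have -> : mass (predC1 o) = 1 - mass (pred1 o) by rewrite -massC.
  by rewrite /mass big_pred1_eq; move: so; lra.
move=> /(closed_medium co) [D cD /andP[D1 D2]].
by exists D, D; split=> // G n z; apply: surv_from_closed.
Qed.

(** Averaging over [D], of mass at least 1/4, costs the factor 4; the part of [G] outside [K] keeps
    mass 7/8 - 1/2 = 3/8. *)
Lemma surv_from_root (G : pred C) u : 7 / 8 <= mass G ->
  surv G u o <= 4 * (1 - (1 - lam) * (3 / 8)) ^+ u.
Proof.
move=> Gm; have [D [K [D4 K2 DK]]] := separating_sets.
set G' := fun y => G y && ~~ K y.
have G'm : 3 / 8 <= mass G'.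
  have h := massD G K.
  have e : mass (predD G K) = mass G' by apply: eq_bigl => y; rewrite /= /G' andbC.
  by move: h; rewrite e; move: Gm K2; lra.
apply: le_trans (_ : surv G' u o <= _); first by apply: surv_sub => y /andP[].
apply: le_trans (_ : 4 * mean (surv G' u) <= _).
  have s0 := surv_ge0 G' u o.
  apply: le_trans (_ : 4 * (mass D * surv G' u o) <= _).
    by move: D4 s0; move: (mass D) (surv _ _ _) => d s; nra.
  rewrite ler_wpM2l // /mass mulr_suml /mean big_mkcond /=; apply: ler_sum => z _.
  case: ifP => Dz; last by rewrite mulr_ge0 ?stat_ge0 ?surv_ge0.
  by rewrite ler_wpM2l ?stat_ge0 // DK.
rewrite ler_wpM2l //; apply: le_trans (mean_surv_le rev lz lam0 lam1 gap G' u) _.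
have r0 := killed_rate_ge0 lam0 lam1 G'; have m1 := mass_ge0 G'.
apply: le_trans (_ : 1 * (1 - (1 - lam) * mass G') ^+ u <= _).
  by rewrite ler_wpM2r ?exprn_ge0 //; move: m1; lra.
have l1 : 0 <= 1 - lam by rewrite subr_ge0 ltW.
have := ler_wpM2l l1 G'm => h.
by rewrite mul1r lerXn2r ?nnegrE //; move: h r0; lra.
Qed.

(** * The window for one chain and one level *)

Section Bound.
Variables (eps : R) (n0 tm : nat).
Hypothesis eps0 : 0 < eps.
Hypothesis eps4 : eps <= 4^-1.
Hypothesis mix_n0 : mix_dist C n0 <= 1 - eps.
Hypothesis mix_tm : mix_dist C tm <= 4^-1.

Let y := Num.sqrt eps^-1.

Let y2 : 2 <= y.
Proof.
have -> : (2 : R) = Num.sqrt 4.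
  by rewrite (_ : 4 = 2 ^+ 2) ?sqrtr_sqr ?normr_nat // -natrX.
rewrite ler_sqrt; last by rewrite invr_ge0 ltW.
by rewrite -[leLHS]invrK lef_pV2 ?posrE ?invr_gt0.
Qed.

Let y0 : 0 < y. Proof. by apply: lt_le_trans y2. Qed.
Let epsE : eps = (y ^+ 2)^-1.
Proof. by rewrite sqr_sqrtr ?invr_ge0 ?invrK // ltW. Qed.

(** The common form of the waiting times: $(1-b/T)^n\le e^{-nb/T}\le e^{-ky}\le\epsilon^k$. *)
Let decay b n k : 0 <= b <= T -> k%:R * y * T <= n%:R * b -> (1 - b / T) ^+ n <= eps ^+ k.
Proof.
move=> /andP[b0 bT] h; rewrite epsE; apply: pow1B_le => //.
  by rewrite subr_ge0 ler_pdivrMr // mul1r.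
by rewrite mulrA ler_pdivlMr.
Qed.

(** At time [n0] the law is within [1 - eps] of stationarity, and a stationary start stays in the
    component [B] for [r] more steps with probability at most [mass B * eps <= eps / 2]. The factor
    2 in the wait compensates the mass 1/2 outside [B]. *)
Lemma surv_root_lower r x : 2 * y * T <= r%:R ->
  surv (pred1 o) (n0 + r) x <= 1 - eps / 2.
Proof.
move=> hr; have [->|xo] := eqVneq x o.
  by rewrite surv_in /= ?eqxx //; move: eps4; lra.
have [B [Bx cB Bh]] := component xo.
apply: le_trans (surv_component _ cB Bx) _.
apply: le_trans (survD_le _ _ _ _) _.
apply: le_trans (iter_avg_le_tv _ _ _) _.
  by move=> z; rewrite surv_ge0 surv_le1.
have := le_trans (tv_le_mix_dist n0 x) mix_n0.
suff : mean (surv (predC B) r) <= eps / 2 by move: (mean _) (tv_dist _ _) => a b; lra.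
apply: le_trans (mean_surv_le rev lz lam0 lam1 gap _ _) _.
rewrite massC opprB addrC subrK TV mulrC.
have B0 := mass_ge0 B; have B1 := mass_le1 B; have T1 : 1 <= T := t_rel_ge1.
have p1 : (1 - T^-1 * (1 - mass B)) ^+ r <= eps.
  rewrite [T^-1 * _]mulrC -[leRHS]expr1; apply: decay.
    by apply/andP; split; [move: B1; lra | move: B0 T1; lra].
  apply: le_trans (_ : r%:R * 2^-1 <= _).
    by move: hr; rewrite -mulrA mul1r; move: (y * T) (r%:R) => a b; lra.
  by rewrite ler_wpM2l //; move: Bh; lra.
have p0 : 0 <= (1 - T^-1 * (1 - mass B)) ^+ r.
  have := killed_rate_ge0 lam0 lam1 (predC B); rewrite massC TV; exact: exprn_ge0.
exact: ler_pM.
Qed.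

(** After [tm] steps the chain is in its initial component with probability at most 1/2 + 1/4,
    whence [q = 3 / 4]. *)
Lemma hit_mean_le_mix x : hit_mean Et o x <= 4 * tm%:R.
Proof.
have -> : 4 * tm%:R = tm%:R / (1 - 3 / 4) :> R by field.
apply: (hit_mean_le Et lzE rev (N := tm) (q := 3 / 4)); first by lra.
move=> {}x; have [->|xo] := eqVneq x o; first by rewrite surv_in /= ?eqxx //; lra.
have [B [Bx cB Bh]] := component xo.
apply: le_trans (surv_component _ cB Bx) _.
apply: le_trans (_ : iter tm avg (fun z => (B z)%:R) x <= _).
  by apply: surv_le_iter => z /=; rewrite ?negbK.
apply: le_trans (iter_avg_le_tv _ _ _) _; first by move=> z; case: (B z); rewrite ?lexx ?ler01.
have := le_trans (tv_le_mix_dist tm x) mix_tm.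
by rewrite mean_indic; move: (tv_dist _ _) Bh => t; lra.
Qed.

Let Z := Num.sqrt (eps^-1 * T * tm%:R).

Let tm0 : 0 < tm%:R :> R.
Proof. by have := t_rel_le_mix mix_tm; move: T0; lra. Qed.

Let X0 : 0 < eps^-1 * T * tm%:R.
Proof. by apply: mulr_gt0 (mulr_gt0 _ T0) tm0; rewrite invr_gt0. Qed.

Let Z2 : Z ^+ 2 = eps^-1 * T * tm%:R.
Proof. by rewrite sqr_sqrtr // ltW. Qed.

Let Zpos : 0 < Z.
Proof. by rewrite sqrtr_gt0. Qed.

(** From [T <= 2 * tm]; the constant 10/7 is a rational above $\sqrt2$. *)
Let yT : y * T <= 10 / 7 * Z.
Proof.
have e0 : 0 < eps^-1 by rewrite invr_gt0.
rewrite -ler_sqr ?nnegrE; [|exact: ltW (mulr_gt0 y0 T0)|by rewrite mulr_ge0 // ltW].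
rewrite !exprMn Z2 (sqr_sqrtr (ltW e0)).
have h := t_rel_le_mix mix_tm.
have := ler_wpM2l (ltW (mulr_gt0 e0 T0)) h; rewrite !expr2 => h2.
by move: X0 h2; move: (eps^-1) T (tm%:R) => a b c'; lra.
Qed.

(** The variance is at most [16 * T * tm], and 17/3 is a rational just above $\sqrt{32}$. *)
Let var_le x : hit_var Et o x <= eps / 2 * (17 / 3 * Z) ^+ 2.
Proof.
apply: le_trans (hit_var_le lzE rev lam1 gap heavy x) _.
rewrite TV invrK exprMn Z2.
have -> : eps / 2 * ((17 / 3) ^+ 2 * (eps^-1 * T * tm%:R)) = (17 / 3) ^+ 2 / 2 * (T * tm%:R).
  by field; rewrite gt_eqF.
have := ler_wpM2l (ltW T0) (hit_mean_le_mix x).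
have := mulr_ge0 (ltW T0) (ltW tm0).
by rewrite !expr2; move: (hit_mean _ _ _) T (tm%:R) => a b c'; lra.
Qed.

(** A hit by time [n0 + r] has probability at least [eps / 2]; the lower tail forbids this if the
    mean is much larger. *)
Lemma hit_mean_concentrated r x : 2 * y * T <= r%:R ->
  hit_mean Et o x <= (n0 + r)%:R + 17 / 3 * Z.
Proof.
move=> hr; set N := (n0 + r)%N; set m := hit_mean _ _ _.
have [h|h] := lerP m N%:R; first by apply: le_trans h _; rewrite lerDl mulr_ge0 // ltW.
have := hit_lower_tail Et lzE rev o x (ltW h); rewrite -/m subrr expr0n addr0 => h1.
have s := surv_root_lower x hr; rewrite -/N in s.
have h2 : eps / 2 * (m - N%:R) ^+ 2 <= eps / 2 * (17 / 3 * Z) ^+ 2.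
  apply: le_trans (le_trans h1 (var_le x)); rewrite ler_wpM2r ?sqr_ge0 //; move: s; lra.
move: h2; rewrite ler_pM2l ?divr_gt0 // ler_sqr ?nnegrE; first by lra.
  by rewrite subr_ge0 ltW.
by rewrite mulr_ge0 // ltW.
Qed.

(** 34/3 is twice 17/3: one deviation for the position of the mean, one for the upper tail. *)
Lemma surv_root_upper r n1 x : 2 * y * T <= r%:R ->
  (n0 + r)%:R + 34 / 3 * Z <= n1%:R -> surv (pred1 o) n1 x <= eps / 2.
Proof.
move=> hr hn; have hm := hit_mean_concentrated x hr; set m := hit_mean _ _ _ in hm.
have k0 : 0 < 17 / 3 * Z by rewrite mulr_gt0.
have mn : 17 / 3 * Z <= n1%:R - m by move: hm hn; lra.
have mn' : m <= n1%:R by move: mn k0; lra.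
have := hit_upper_tail Et lzE rev o x mn'; rewrite -/m subrr expr0n addr0 => h1.
have s0 := surv_ge0 (pred1 o) n1 x.
have k2 : 0 < (17 / 3 * Z) ^+ 2 by rewrite exprn_gt0.
rewrite -(ler_pM2r k2); apply: le_trans (var_le x); apply: le_trans h1.
by rewrite ler_wpM2l // ler_sqr ?nnegrE ?(ltW k0) // (le_trans (ltW k0)).
Qed.

(** The error splits into [eps / 2] for not hitting [o] by time [n1], [eps / 4] for not meeting [G]
    in the next [u] steps, and [eps / 4] for the distance after meeting [G] with at least [s] steps
    left. *)
Lemma mixed_at r n1 u s : 2 * y * T <= r%:R ->
  (n0 + r)%:R + 34 / 3 * Z <= n1%:R -> 8 * y * T <= u%:R -> 4 * y * T <= s%:R ->
  mix_dist C (n1 + u + s) <= eps.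
Proof.
move=> hr hn hu hs; apply/mix_dist_leP; first exact: ltW.
move=> x; apply: tv_dist_le => A; set f := fun y => _.
have f0 : mean f = 0 := mean_centered A.
have [g gP gm] := maximal_inequality rev lz lam0 lam1 gap f0 s (n1 + u).
(* From [G] the iterates of [f] are at most [eps / 4] at all times covered by [gP]; Markov's
   inequality for [g] gives mass at least 7/8. *)
pose G z := g z <= (eps / 4) ^+ 2.
have T1 : 1 <= T := t_rel_ge1.
have ls : lam ^+ s <= eps ^+ 4.
  have -> : lam = 1 - 1 / T by rewrite div1r -TV opprB addrC subrK.
  by apply: decay; [rewrite ler01 | rewrite mulr1].
have ls0 : 0 <= lam ^+ s := exprn_ge0 s lam0.
have df := dot_centered_le A; rewrite -/f in df; have df0 := dot_ge0 f.
have a1 := dot_iter_avg_le rev lz lam0 gap f0 s.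
have a2 := dot_iter_avg_le rev lz lam0 gap f0 (s + s); rewrite exprD in a2.
have q4 : 0 <= eps ^+ 4 by rewrite exprn_ge0 // ltW.
have b1 : dot (iter s avg f) f <= eps ^+ 4 / 4.
  by apply: le_trans a1 _; apply: ler_pM.
have b2 : dot (iter (s + s) avg f) f <= eps ^+ 4 * eps ^+ 4 / 4.
  apply: le_trans a2 _; apply: ler_pM => //; first exact: mulr_ge0.
  exact: ler_pM.
(* [s >= 4 * y * T] and [y >= 2] give [s >= 8 * T]. *)
have Ts : T / s.+1%:R <= 8^-1.
  rewrite ler_pdivrMr ?ltr0n // -[s.+1%:R]natr1; move: hs (ler_wpM2r (ltW T0) y2).
  by move: y T (s%:R) => a b c; lra.
have gm' : mean g <= (eps / 4) ^+ 2 / 8.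
  apply: le_trans gm _; rewrite -/lam -[(1 - lam)^-1]/T.
  have c1 : T * dot (iter s avg f) f / s.+1%:R <= 8^-1 * (eps ^+ 4 / 4).
    rewrite mulrAC; apply: ler_pM => //; first by rewrite divr_ge0 ?(ltW T0).
    by apply: dot_iter_ge0; [exact: avg_selfadjoint | exact: avg_psd].
  have c2 : eps ^+ 4 <= eps ^+ 2 / 16.
    have -> : eps ^+ 4 = eps ^+ 2 * eps ^+ 2 by rewrite -exprD.
    rewrite ler_wpM2l ?sqr_ge0 // (_ : 16^-1 = 4^-1 ^+ 2); last by field.
    by rewrite ler_sqr ?nnegrE ?invr_ge0 // ltW.
  have c3 : eps ^+ 4 * eps ^+ 4 <= eps ^+ 4 / 16.
    rewrite ler_wpM2l //; apply: le_trans c2 _; rewrite ler_piMl ?invr_ge0 //.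
    by rewrite exprn_ile1 ?(ltW eps0) //; move: eps4; lra.
  rewrite expr_div_n; move: b2 c1 c2 c3 q4 (sqr_ge0 eps).
  move: (eps ^+ 4 * eps ^+ 4) (eps ^+ 4) (eps ^+ 2) (T * _ / _) (dot (iter (s + s) _ _) _).
  by move=> e8 e4 e2 v w; rewrite !expr2; lra.
have e42 : 0 < (eps / 4) ^+ 2 by rewrite exprn_gt0 // divr_gt0.
have g0 z : 0 <= g z.
  by apply: le_trans (gP z s _); rewrite ?sqr_ge0 // leqnn leq_addr.
have Gm : 7 / 8 <= mass G.
  suff : mass (predC G) <= 8^-1 by rewrite massC; lra.
  rewrite -(ler_pM2l e42); apply: le_trans gm'.
  rewrite /mass mulr_sumr /mean big_mkcond /=; apply: ler_sum => z _.
  rewrite /G -ltNge; case: ifP => [h|_]; last by rewrite mulr_ge0 ?stat_ge0.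
  by rewrite mulrC ler_wpM2l ?stat_ge0 // ltW.
have f1 z : f z <= 1.
  by rewrite /f; case: (A z); have := mass_ge0 A; rewrite /= ?mulr1n ?mulr0n; lra.
have e40 : 0 <= eps / 4 by rewrite divr_ge0 // ltW.
have := @iter_avg_le_surv _ _ G s (n1 + u) f (eps / 4) x f1 e40.
move=> /(_ _) h; apply: le_trans (h _) _.
  move=> z j Gz; rewrite addnC => sj; have := le_trans (gP z j sj) Gz.
  have [h0 _|h0] := lerP (iter j avg f z) 0; first exact: le_trans h0 e40.
  by rewrite ler_sqr ?nnegrE // ltW.
have t1 := surv_through G o n1 u x; have t2 := surv_root_upper x hr hn.
have t3 : surv G u o <= eps / 4.
  apply: le_trans (surv_from_root u Gm) _; rewrite TV mulrC [T^-1 * _]mulrC.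
  (* The wait [8 * y * T] at rate 3/8 yields the exponent 3, whose two spare powers of [eps] absorb
     the factor 4. *)
  have d : (1 - 3 / 8 / T) ^+ u <= eps ^+ 3.
    apply: decay; first by apply/andP; split; move: T1; lra.
    by move: hu; rewrite -!mulrA; move: (y * T) (u%:R) => a b; lra.
  have e2 : eps ^+ 2 <= 16^-1.
    by rewrite (_ : 16^-1 = 4^-1 ^+ 2); [rewrite ler_sqr ?nnegrE ?invr_ge0 // ltW | field].
  have e3 : eps ^+ 3 <= eps / 16 by rewrite exprS ler_wpM2l // ltW.
  by move: d e3; move: ((1 - _) ^+ u) (eps ^+ 3) => a b; lra.
move: t1 t2 t3; move: (surv _ _ _) (surv _ _ _) (surv _ _ _) => v1 v2 v3; lra.
Qed.

Lemma mixed_soon : exists2 n, mix_dist C n <= eps & n%:R <= n0%:R + 35 * Z.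
Proof.
have yT0 : 0 <= y * T := ltW (mulr_gt0 y0 T0).
have z0 : 0 <= 34 / 3 * Z by rewrite mulr_ge0 // ltW.
have [r /andP[r1 r2]] := nat_ceil (mulr_ge0 (ler0n R 2) yT0).
have [u /andP[u1 u2]] := nat_ceil (mulr_ge0 (ler0n R 8) yT0).
have [s /andP[s1 s2]] := nat_ceil (mulr_ge0 (ler0n R 4) yT0).
have [n1 /andP[m1 m2]] := nat_ceil (addr_ge0 (ler0n R (n0 + r)) z0).
exists (n1 + u + s)%N; first by apply: (@mixed_at r) => //; rewrite -mulrA.
have yT2 : 2 <= y * T.
  have T1 : 1 <= T := t_rel_ge1; move: y2 T1; move: y T => a b; nra.
rewrite natrD natrD; move: m2; rewrite natrD; move: r2 u2 s2 yT yT2 Zpos.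
by move: (y * T) Z (n1%:R) (u%:R) (s%:R) (n0%:R) (r%:R) => *; lra.
Qed.

End Bound.
End TreeMixing.

(** * Cutoff *)

Section TreeWindow.
Variables (R : realType) (C : markovChain R) (E : rel C).
Hypothesis Et : is_tree E.
Hypothesis lzE : lazy_on E.
Hypothesis rev : reversible C.
Hypothesis C2 : (2 <= #|C|)%N.

Let mixes (eps : R) : 0 < eps -> exists t, mix_dist C t <= eps.
Proof.
apply: (mix_dist_small rev lzE.2 (stat_gt0 Et lzE rev) (lambda2_ge0 Et lzE rev C2)).
  exact: lambda2_lt1 Et lzE rev C2.
exact: lambda2_gap Et lzE rev C2.
Qed.

Lemma t_mix_le (a b : R) : 0 < a -> a <= b -> t_mix C b <= t_mix C a.
Proof.
move=> a0 ab; have [n [-> hn _]] := t_mixP (mixes a0).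
have [m [-> _ mmin]] := t_mixP (mixes (lt_le_trans a0 ab)).
by rewrite ler_nat; apply: mmin; apply: le_trans hn ab.
Qed.

Let quarter_gt0 : (0 : R) < 4^-1. Proof. by rewrite invr_gt0 ltr0n. Qed.

Lemma t_rel_le_t_mix : t_rel C <= 2 * t_mix C 4^-1.
Proof.
have [tm [-> htm _]] := t_mixP (mixes quarter_gt0).
exact: t_rel_le_mix Et lzE rev C2 tm htm.
Qed.

Lemma t_mix_quarter_gt0 : 0 < t_mix C 4^-1.
Proof. by have := t_rel_le_t_mix; have := t_rel_ge1 Et lzE rev C2; lra. Qed.

Lemma tree_window (eps : R) : 0 < eps <= 4^-1 ->
  t_mix C eps - t_mix C (1 - eps)
    <= 35 * Num.sqrt (eps^-1 * t_rel C * t_mix C 4^-1).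
Proof.
move=> /andP[e0 e4]; have [c heavy] := centroid_exists Et.
have [tm [-> htm _]] := t_mixP (mixes quarter_gt0).
have e1 : 0 < 1 - eps by move: e4; lra.
have [n0 [-> hn0 _]] := t_mixP (mixes e1).
have [n [-> _ nmin]] := t_mixP (mixes e0).
have [m hm hm2] := mixed_soon lzE rev C2 heavy e0 e4 hn0 htm.
rewrite lerBlDl; apply: le_trans hm2; rewrite ler_nat; exact: nmin.
Qed.

(** Monotonicity of [t_mix] reduces every level to the smaller [e], which is at most 1/4. The last
    bound keeps [t_mix C (1 - eps)] comparable to [t_mix C 4^-1], as needed in the cutoff ratio. *)
Lemma tree_window_all (eps : R) : 0 < eps < 1 ->
  let e := Num.min eps (Num.min (1 - eps) 4^-1) in
  let c := 35 * Num.sqrt e^-1 in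
  let w := Num.sqrt (t_rel C * t_mix C 4^-1) in
  [/\ t_mix C eps - t_mix C (1 - eps) <= c * w,
      t_mix C (1 - eps) - t_mix C eps <= c * w
    & t_mix C 4^-1 - t_mix C (1 - eps) <= c * w].
Proof.
move=> /andP[e0 e1] e c w.
have ep : 0 < e by rewrite !lt_min e0 subr_gt0 e1 invr_gt0 ltr0n.
have l1 : e <= eps by rewrite ge_min lexx.
have l2 : e <= 1 - eps by rewrite !ge_min lexx !orbT.
have l3 : e <= 4^-1 by rewrite !ge_min lexx !orbT.
have W : t_mix C e - t_mix C (1 - e) <= c * w.
  have := @tree_window e; rewrite ep l3 => /(_ isT).
  by rewrite -mulrA sqrtrM ?invr_ge0 ?(ltW ep) // mulrA.
have up (b : R) : e <= b -> t_mix C b <= t_mix C e by apply: t_mix_le.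
have dn (b : R) : e <= b -> b <= 1 - e -> t_mix C (1 - e) <= t_mix C b.
  by move=> eb; apply: t_mix_le; apply: lt_le_trans ep eb.
have d1 : t_mix C (1 - e) <= t_mix C (1 - eps) by apply: dn => //; move: l1; lra.
have d2 : t_mix C (1 - e) <= t_mix C eps by apply: dn => //; move: l2; lra.
have u1 := up _ l1; have u2 := up _ l2; have u3 := up _ l3.
by split; move: W u1 u2 u3 d1 d2; lra.
Qed.

End TreeWindow.

Theorem theorem1 (R : realType) :
  (forall (C : markovChain R) (E : rel C),
     is_tree E -> lazy_on E -> reversible C -> (3 <= #|C|)%N ->
     forall eps : R, 0 < eps <= 4^-1 ->
       t_mix C eps - t_mix C (1 - eps)
         <= 35 * Num.sqrt (eps^-1 * t_rel C * t_mix C 4^-1)) /\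
  (forall (C : nat -> markovChain R) (E : forall n, rel (C n)),
     (forall n, [/\ is_tree (E n), lazy_on (E n), reversible (C n)
                  & (2 <= #|C n|)%N]) ->
     (fun n => t_rel (C n)) =o_\oo (fun n => t_mix (C n) 4^-1) ->
     exhibits_cutoff C /\
     has_cutoff_window C
       (fun n => Num.sqrt (t_rel (C n) * t_mix (C n) 4^-1))).
Proof.
split=> [C E Et lzE rev C3 eps heps|C E HC product].
  exact: tree_window Et lzE rev (ltnW C3) eps heps.
pose w n := Num.sqrt (t_rel (C n) * t_mix (C n) 4^-1).
pose tm n := t_mix (C n) 4^-1.
have tm0 n : 0 < tm n by have [Et lzE rev C2] := HC n; apply: (t_mix_quarter_gt0 Et).
have w0 n : 0 <= w n by exact: sqrtr_ge0.
(* The product condition at level [d ^+ 2] passes to the square root [w]. *)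
have small d : 0 < d -> \forall n \near \oo, w n <= d * tm n.
  move=> d0; move/eqoP: product => /(_ (d ^+ 2)) H.
  near=> n; have : `|t_rel (C n)| <= d ^+ 2 * `|tm n|.
    by near: n; apply: H; rewrite exprn_gt0.
  rewrite (gtr0_norm (tm0 n)) => /(le_trans (ler_norm _)) h.
  have -> : d * tm n = Num.sqrt ((d * tm n) ^+ 2).
    by rewrite sqrtr_sqr ger0_norm // mulr_ge0 // ltW.
  rewrite ler_sqrt ?sqr_ge0 // exprMn [tm n ^+ 2]expr2 mulrA.
  exact: ler_wpM2r (ltW (tm0 n)) _ _ h.
have win (eps : R) n : 0 < eps < 1 ->
    let c := 35 * Num.sqrt (Num.min eps (Num.min (1 - eps) 4^-1))^-1 in
    [/\ t_mix (C n) eps - t_mix (C n) (1 - eps) <= c * w n,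
        t_mix (C n) (1 - eps) - t_mix (C n) eps <= c * w n
      & tm n - t_mix (C n) (1 - eps) <= c * w n].
  by have [Et lzE rev C2] := HC n; apply: (tree_window_all Et).
have cpos (eps : R) : 0 < eps < 1 ->
    0 < 35 * Num.sqrt (Num.min eps (Num.min (1 - eps) 4^-1))^-1.
  move=> /andP[e0 e1]; rewrite mulr_gt0 // sqrtr_gt0 invr_gt0 !lt_min e0 subr_gt0 e1.
  by rewrite invr_gt0 ltr0n.
split; last first.
  split; last by move=> eps he; eexists; [exact: cpos he | move=> n; case: (win eps n he)].
  apply/eqoP => d d0; near=> n.
  rewrite (ger0_norm (w0 n)) (gtr0_norm (tm0 n)); near: n; exact: small.
move=> eps he; apply/cvgrPdist_le => d d0.
set c := 35 * Num.sqrt (Num.min eps (Num.min (1 - eps) 4^-1))^-1.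
have c0 : 0 < c := cpos eps he.
(* The bound 1/2 keeps the denominator at least half of [tm n]; the bound [d / 2] then makes the
   relative error at most [d]. *)
pose k := Num.min (2^-1) (d / 2).
have k0 : 0 < k by rewrite lt_min invr_gt0 ltr0n divr_gt0.
have k1 : k <= 2^-1 by rewrite ge_min lexx.
have k2 : k <= d / 2 by rewrite ge_min lexx orbT.
near=> n.
have wn : w n <= k / c * tm n by near: n; apply: small; rewrite divr_gt0.
have cw : c * w n <= k * tm n.
  by have := ler_wpM2l (ltW c0) wn; rewrite mulrA mulrCA divff ?gt_eqF // mulr1.
have [] := win eps n he; rewrite -/c.
set a := t_mix _ _; set b := t_mix _ (1 - eps) => h1 h2 h3.
have t0 := tm0 n.
have b0 : tm n / 2 <= b.
  have := ler_wpM2r (ltW t0) k1; move: cw h3; move: (c * w n) (k * tm n) => x y; lra.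
have bp : 0 < b by move: b0 t0; lra.
have -> : 1 - a / b = (b - a) / b by field; rewrite gt_eqF.
rewrite normrM normfV (gtr0_norm bp) ler_pdivrMr //.
apply: le_trans (_ : k * tm n <= _).
  by rewrite ler_norml; apply/andP; split; move: cw h1 h2; lra.
have := ler_wpM2r (ltW t0) k2; have := ler_wpM2l (ltW d0) b0; lra.
Unshelve. all: by end_near.
Qed.
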